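(* For $n\ge1$ let $M_n$ be the square matrix with rows and columns indexed by the simple $n$-braids, with $$(M_n)_{s,t}=\begin{cases}1&\text{if the sequence }(s,t)\text{ is normal},\\0&\text{otherwise.}\end{cases}$$ Then, for all $n\ge r\ge1$ and $d\ge1$, $$h_r(\Delta_n^d)=\big((1,1,\dots,1)\,M_n^{\,d}\big)_{\Delta_r},$$ and, for all $n\ge2$ and $d\ge1$, $$c(\Delta_n^d)=\big((1,1,\dots,1)\,M_n^{\,d}\big)_{\Delta_{n-1}}-1 .$$ Here $(1,\dots,1)$ is the row vector with all entries $1$, and $(\cdot)_{t}$ denotes the entry indexed by the simple braid $t$.
   Context: Braids. $B_n$ ($n\ge1$) is the braid group with generators $\sigma_1,\dots,\sigma_{n-1}$ and relations $\sigma_i\sigma_j=\sigma_j\sigma_i$ for $|i-j|\ge2$, $\sigma_i\sigma_j\sigma_i=\sigma_j\sigma_i\sigma_j$ for $|i-j|=1$; $B_\infty$ is the direct limit of the $B_n$. $B_n^+$, $B_\infty^+$ are the monoids with the same presentations; they embed in the groups and their elements are called positive braids. For positive braids, $x\preccurlyeq y$ means $y=xt$ for some positive braid $t$, and $\mathrm{Div}(y)=\{x\in B_\infty^+ : x\preccurlyeq y\}$. $\Delta_1=1$ and $\Delta_n=\sigma_1\sigma_2\cdots\sigma_{n-1}\Delta_{n-1}$. Simple $n$-braids are the $n!$ elements of $\mathrm{Div}(\Delta_n)$. A sequence $(s_1,\dots,s_d)$ of simple $n$-braids is normal if $s_k=\gcd(\Delta_n,s_k s_{k+1}\cdots s_d)$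 (greatest common left divisor in the lattice $(B_n^+,\preccurlyeq)$) for each $k$. Ordering. A braid word is a word in the letters $\sigma_i^{\pm1}$; $[w]$ denotes the braid represented by $w$. The main generator of a nonempty braid word is $\sigma_m$ where $m$ is the largest index such that $\sigma_m$ or $\sigma_m^{-1}$ occurs; the word is $\sigma$-positive if its main generator $\sigma_m$ occurs but $\sigma_m^{-1}$ does not. The main generator of a positive braid $z\neq1$ is that of any positive word representing it. Heights. For $r\ge1$, $x<_r y$ means that $x^{-1}y$ has a $\sigma$-positive expression whose main generator is $\sigma_m$ with $m\ge r$; this is a strict partial order. The $r$-height $h_r(z)$ of a positive braid $z$ is the maximal length (number of elements) of a $<_r$-chain contained in $\mathrm{Div}(z)$. Complexity. A braid word $w$ is drawn in $\Gamma(z)$ from $x\in\mathrm{Div}(z)$ if $x[v]\in\mathrm{Div}(z)$ for every prefix $v$ of $w$. For a positive braid $z\neq1$ with main generator $\sigma_m$, the complexity $c(z)$ is the maximal number of letters $\sigma_m$ in a $\sigma$-positive word drawn in $\Gamma(z)$ from some $x\in\mathrm{Div}(z)$. *)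

(* Defs.v *)
From HB Require Import structures.
From mathcomp Require Import all_boot all_order all_algebra.
From mathcomp Require Import finmap.
From mathcomp Require Import boolp classical_sets cardinality.

Set Implicit Arguments.
Unset Strict Implicit.
Unset Printing Implicit Defensive.

Local Open Scope quotient_scope.
Local Open Scope group_scope.

Local Notation "\prod_ ( i < n ) F" := (\big[*%g/1]_(i < n) F) : group_scope.
Local Notation "\prod_ ( i <- r ) F" := (\big[*%g/1]_(i <- r) F) : group_scope.

Inductive cong (T : Type) (R : seq T -> seq T -> Prop) : seq T -> seq T -> Prop :=
| cong_rel u v a b : R a b -> cong R (u ++ a ++ v) (u ++ b ++ v)
| cong_refl u : cong R u u
| cong_sym u v : cong R u v -> cong R v u
| cong_trans u v w : cong R u v -> cong R v w -> cong R u w.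

Section Presentation.
Variables (T : choiceType) (R : seq T -> seq T -> Prop).

Definition congb (u v : seq T) : bool := `[< cong R u v >].

Lemma congb_refl : reflexive congb.
Proof. by move=> u; apply/asboolP; apply: cong_refl. Qed.

Lemma congb_sym : symmetric congb.
Proof. by move=> u v; apply/asboolP/asboolP; apply: cong_sym. Qed.

Lemma congb_trans : transitive congb.
Proof.
by move=> v u w /asboolP uv /asboolP vw; apply/asboolP; apply: cong_trans vw.
Qed.

Canonical congb_equiv := EquivRel congb congb_refl congb_sym congb_trans.

Definition presented := {eq_quot congb_equiv}.

HB.instance Definition _ := Choice.on presented.
HB.instance Definition _ := EqQuotient.on presented.

Definition cls (u : seq T) : presented := \pi_presented u.

Lemma clsP u v : cls u = cls v <-> cong R u v.
Proof.
split=> [/eqP|uv]; first by rewrite /cls eqmodE => /asboolP.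
by apply/eqP; rewrite /cls eqmodE; apply/asboolP.
Qed.

Lemma cls_repr x : cls (repr x) = x.
Proof. exact: reprK. Qed.

Lemma cong_catl w u v : cong R u v -> cong R (w ++ u) (w ++ v).
Proof.
elim=> [u' v' a b ab|u'|u' v' _ IH|u' v' w' _ IH _ IH'].
- by rewrite !(catA w); apply: cong_rel.
- exact: cong_refl.
- exact: cong_sym.
- exact: cong_trans IH IH'.
Qed.

Lemma cong_catr w u v : cong R u v -> cong R (u ++ w) (v ++ w).
Proof.
elim=> [u' v' a b ab|u'|u' v' _ IH|u' v' w' _ IH _ IH'].
- by rewrite -!catA; apply: cong_rel.
- exact: cong_refl.
- exact: cong_sym.
- exact: cong_trans IH IH'.
Qed.

Definition pres_one : presented := cls [::].
Definition pres_mul (x y : presented) : presented := cls (repr x ++ repr y).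

Lemma pres_mulE u v : pres_mul (cls u) (cls v) = cls (u ++ v).
Proof.
apply/clsP; apply: (@cong_trans _ _ _ (u ++ repr (cls v))).
  by apply/cong_catr/clsP; rewrite cls_repr.
by apply/cong_catl/clsP; rewrite cls_repr.
Qed.

Lemma pres_mulA : associative pres_mul.
Proof.
move=> x y z; rewrite -(cls_repr x) -(cls_repr y) -(cls_repr z).
by rewrite !pres_mulE catA.
Qed.

Lemma pres_mul1 : left_id pres_one pres_mul.
Proof. by move=> x; rewrite -(cls_repr x) pres_mulE. Qed.

Lemma pres_1mul : right_id pres_one pres_mul.
Proof. by move=> x; rewrite -(cls_repr x) pres_mulE cats0. Qed.

HB.instance Definition _ :=
  isMonoid.Build presented pres_mulA pres_mul1 pres_1mul.

Lemma clsM u v : cls (u ++ v) = cls u * cls v.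
Proof. by rewrite -pres_mulE. Qed.

Lemma cls1 : cls [::] = 1.
Proof. by []. Qed.

End Presentation.

(* Generators are numbered from 0: the letter [i : nat] stands for
   sigma_{i+1}.  The relations are those of all the B_n at once, i.e. of
   their direct limit. *)
Inductive artin : seq nat -> seq nat -> Prop :=
| artin_far i j : (i.+2 <= j)%N || (j.+2 <= i)%N -> artin [:: i; j] [:: j; i]
| artin_near i j : (i.+1 == j) || (j.+1 == i) ->
    artin [:: i; j; i] [:: j; i; j].

(* B_infty^+ *)
Definition posbraid := presented artin.
HB.instance Definition _ := Monoid.on posbraid.
HB.instance Definition _ := EqQuotient.on posbraid.

Definition pcls (u : seq nat) : posbraid := cls artin u.
Definition sigma (i : nat) : posbraid := pcls [:: i].

(* The letter (i, true) stands for sigma_{i+1}, and (i, false) for its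
   inverse. *)
Definition bword := seq (nat * bool).

Definition pos_word (u : seq nat) : bword := [seq (i, true) | i <- u].

Inductive artin_grp : bword -> bword -> Prop :=
| artin_grp_pos u v : artin u v -> artin_grp (pos_word u) (pos_word v)
| artin_grp_inv i b : artin_grp [:: (i, b); (i, ~~ b)] [::].

(* B_infty *)
Definition braid := presented artin_grp.
HB.instance Definition _ := Monoid.on braid.
HB.instance Definition _ := EqQuotient.on braid.

Definition bcls (w : bword) : braid := cls artin_grp w.

Definition inv_word (w : bword) : bword := rev [seq (l.1, ~~ l.2) | l <- w].

Lemma inv_wordK : involutive inv_word.
Proof.
move=> w; rewrite /inv_word map_rev revK -map_comp map_id_in //.
by case=> i b _ /=; rewrite negbK.
Qed.

Lemma mul_inv_word w : cong artin_grp (w ++ inv_word w) [::].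
Proof.
elim: w => [|[i b] w IH]; first exact: cong_refl.
rewrite /inv_word map_cons rev_cons -cats1 cat_cons catA.
apply: (@cong_trans _ _ _ [:: (i, b); (i, ~~ b)]).
  by apply: (cong_catl [:: (i, b)]); apply: (cong_catr [:: (i, ~~ b)] IH).
exact: (cong_rel [::] [::] (artin_grp_inv i b)).
Qed.

Lemma inv_word_mul w : cong artin_grp (inv_word w ++ w) [::].
Proof. by rewrite -{2}(inv_wordK w); apply: mul_inv_word. Qed.

Definition braid_inv (x : braid) : braid := bcls (inv_word (repr x)).

Lemma braid_mulVg : left_inverse 1 braid_inv *%g.
Proof.
move=> x; rewrite -{2}(cls_repr x) -clsM.
by apply/clsP/inv_word_mul.
Qed.

Lemma braid_mulgV : right_inverse 1 braid_inv *%g.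
Proof.
move=> x; rewrite -{1}(cls_repr x) -clsM.
by apply/clsP/mul_inv_word.
Qed.

HB.instance Definition _ := hasInv.Build braid braid_inv.
HB.instance Definition _ := Monoid_isGroup.Build braid braid_mulVg braid_mulgV.

Definition to_braid (x : posbraid) : braid := bcls (pos_word (repr x)).

Lemma cong_pos_word u v :
  cong artin u v -> cong artin_grp (pos_word u) (pos_word v).
Proof.
elim=> {u v} [u v a b ab|u|u v _ IH|u v w _ IH _ IH'].
- by rewrite /pos_word !map_cat; apply: cong_rel; apply: artin_grp_pos.
- exact: cong_refl.
- exact: cong_sym.
- exact: cong_trans IH IH'.
Qed.

Lemma to_braid_cls u : to_braid (pcls u) = bcls (pos_word u).
Proof. by apply/clsP/cong_pos_word/clsP; apply: cls_repr. Qed.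

Lemma to_braid_monoid_morphism : monoid_morphism to_braid.
Proof.
split=> [|x y]; first by rewrite -cls1 to_braid_cls.
rewrite -(cls_repr x) -(cls_repr y) -clsM !to_braid_cls.
by rewrite /pos_word map_cat /bcls clsM.
Qed.

HB.instance Definition _ :=
  isUMagmaMorphism.Build posbraid braid to_braid to_braid_monoid_morphism.

Definition ldiv (x y : posbraid) : Prop := exists t : posbraid, y = x * t.

Definition Div (z : posbraid) : set posbraid := [set x | ldiv x z]%classic.

(* Delta_0 = 1 is a dummy value. *)
Fixpoint Delta (n : nat) : posbraid :=
  if n is n'.+1 then (\prod_(i < n') sigma i) * Delta n' else 1.

(* B_n^+, as the submonoid of B_infty^+ generated by sigma_1 .. sigma_{n-1} *)
Definition in_Bn (n : nat) (x : posbraid) : Prop :=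
  exists2 u : seq nat, x = pcls u & all (fun i => i.+1 < n)%N u.

Definition is_gcd (n : nat) (x y g : posbraid) : Prop :=
  [/\ in_Bn n g, ldiv g x, ldiv g y &
      forall g', in_Bn n g' -> ldiv g' x -> ldiv g' y -> ldiv g' g].

Definition normal_seq (n : nat) (s : seq posbraid) : Prop :=
  (forall x, x \in s -> Div (Delta n) x) /\
  forall k, (k < size s)%N ->
    is_gcd n (Delta n) (\prod_(x <- drop k s) x) (nth 1 s k).

Lemma cong_artin_size u v : cong artin u v -> size u = size v.
Proof.
elim=> {u v} [u v a b ab|//|u v _ -> //|u v w _ -> _ -> //].
by rewrite !size_cat; case: ab.
Qed.

Lemma cong_artin_mem u v : cong artin u v -> u =i v.
Proof.
elim=> {u v} [u v a b ab|//|u v _ IH i|u v w _ IH _ IH' i].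
- move=> i; rewrite !mem_cat; congr (_ || (_ || _)).
  by case: ab => j k _; rewrite !inE; case: (i == j); case: (i == k).
- by rewrite IH.
- by rewrite IH IH'.
Qed.

Lemma finite_Div z : finite_set (Div z).
Proof.
pose w := repr z; pose N := (\max_(i <- w) i).+1.
pose f (p : {n : 'I_(size w).+1 & n.-tuple 'I_N}) : posbraid :=
  pcls [seq val i | i <- val (tagged p)].
apply: (@sub_finite_set _ _ (f @` setT)%classic); last first.
  exact/finite_image/finite_finset.
move=> x [t zxt]; have /clsP wE : pcls w = pcls (repr x ++ repr t).
  by rewrite /pcls clsM !cls_repr.
have szx : (size (repr x) < (size w).+1)%N.
  by rewrite ltnS (cong_artin_size wE) size_cat leq_addr.
have xN i : i \in repr x -> (i < N)%N.
  move=> ix; rewrite ltnS; apply: (@leq_bigmax_seq _ _ xpredT id) => //.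
  by rewrite (cong_artin_mem wE) mem_cat ix.
exists (existT _ (Ordinal szx) (map_tuple inord (in_tuple (repr x)))) => //.
rewrite /f /= -[RHS](cls_repr x) -map_comp map_id_in // => i ix /=.
by rewrite inordK // xN.
Qed.

Definition simples (n : nat) : {fset posbraid} := fset_set (Div (Delta n)).

Lemma mem_simples n x : x \in simples n <-> ldiv x (Delta n).
Proof.
by rewrite /simples in_fset_set; [rewrite inE | apply: finite_Div].
Qed.

Lemma commute_sigma_Delta n : commute (sigma n) (Delta n).
Proof.
suff H m : (m <= n)%N -> commute (sigma n) (Delta m) by exact: H.
elim: m => [|m IH] lemn /=; first exact: commute1.
apply: commuteM; last exact/IH/ltnW.
apply: commute_prod => i _; rewrite /commute -!clsM; apply/clsP.
apply: (cong_rel [::] [::] (@artin_far n i _)); apply/orP; right.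
by apply: leq_trans lemn; rewrite ltnS.
Qed.

Lemma Delta_recr n : Delta n.+1 = Delta n * \prod_(i <- rev (iota 0 n)) sigma i.
Proof.
elim: n => [|n IH]; first by rewrite /= big_ord0 big_nil.
have -> : rev (iota 0 n.+1) = n :: rev (iota 0 n).
  by rewrite -addn1 iotaD rev_cat.
rewrite big_cons -[LHS]/((\prod_(i < n.+1) sigma i) * Delta n.+1) {1}IH.
rewrite big_ord_recr -!mulgA (mulgA (sigma n)) commute_sigma_Delta.
by rewrite -!mulgA.
Qed.

Lemma Delta_simple r n : (r <= n)%N -> Delta r \in simples n.
Proof.
move=> /subnK <-; elim: (n - r)%N => [|k IH]; apply/mem_simples.
  by exists 1; rewrite mulg1.
have /mem_simples [t Dt] := IH; rewrite addSn.
by rewrite /ldiv Delta_recr Dt -mulgA; eexists.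
Qed.

Definition Delta_idx (n r : nat) (rn : (r <= n)%N) : 'I_#|{: simples n}| :=
  enum_rank [` Delta_simple rn]%fset.

Definition Mn (n : nat) : 'M[int]_#|{: simples n}| :=
  (\matrix_(i, j) (`[< normal_seq n [:: val (enum_val i); val (enum_val j)] >])%:R)%R.

(* For [w] nonempty, sigma_{(main_idx w).+1} is the main generator of [w]. *)
Definition main_idx (w : bword) : nat := \max_(l <- w) l.1.

Definition sigma_positive (w : bword) : Prop :=
  [/\ w <> [::], (main_idx w, true) \in w & (main_idx w, false) \notin w].

Definition lt_braid (r : nat) (x y : braid) : Prop :=
  exists w : bword,
    [/\ bcls w = x^-1 * y, sigma_positive w & (r <= (main_idx w).+1)%N].

Definition is_max (P : nat -> Prop) (k : nat) : Prop :=
  P k /\ forall j, P j -> (j <= k)%N.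

Definition lt_chain (r : nat) (A : {fset posbraid}) : Prop :=
  forall x y, x \in A -> y \in A -> x <> y ->
    lt_braid r (to_braid x) (to_braid y) \/ lt_braid r (to_braid y) (to_braid x).

(* The maximum is stated as a relation, so no default value is needed; a chain
   is a finite subset on which [lt_braid r] is total. *)
Definition is_height (r : nat) (z : posbraid) : nat -> Prop :=
  is_max (fun k => exists A : {fset posbraid},
    [/\ forall x, x \in A -> Div z x, lt_chain r A & #|` A|%fset = k]).

(* sigma_{m+1} is the main generator of [z]; false for every [m] if z = 1. *)
Definition main_gen (z : posbraid) (m : nat) : Prop :=
  exists u : seq nat, [/\ u <> [::], z = pcls u & main_idx (pos_word u) = m].

Definition drawn (z x : posbraid) (w : bword) : Prop :=
  forall v : bword, prefix v w ->
    exists2 y, Div z y & to_braid x * bcls v = to_braid y.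

(* [is_complexity z c] : z != 1 and the complexity c(z) is [c]. *)
Definition is_complexity (z : posbraid) (c : nat) : Prop :=
  exists2 m, main_gen z m &
    is_max (fun k => exists x w,
      [/\ Div z x, drawn z x w, sigma_positive w & count_mem (m, true) w = k]) c.

(* Main.v *)
From Stdlib Require Import ZArith.
Require Import Defs.
From mathcomp Require Import all_boot all_order all_algebra.
From mathcomp Require Import finmap zify.
From mathcomp Require Import boolp classical_sets cardinality.
Import GRing.Theory.

Set Implicit Arguments.
Unset Strict Implicit.
Unset Printing Implicit Defensive.

(** The divisors of z = Delta_n^d form a finite graph whose edges are the right
multiplications by the generators.  Dynnikov's action of the braid group on
sequences of pairs of integers shows that a sigma-positive word of main
generator sigma_m never represents a braid of B_m (Property A).  Conversely, in
this graph, let the components be those of the edges sigma_i, i < m.  If two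
edges sigma_m leave (or enter) the same component, their other ends are
joined by a sigma_m-positive, sigma_m-negative or sigma_m-free path: by
induction the path between their near ends is sigma_(m-1)-positive, say, and it
is pushed across by s_m^-1 s_(m-1) s_m = s_(m-1) s_m s_(m-1)^-1, using only
lcms of elements of the graph.  As the sigma_m-positive order is finite and
acyclic, this local property makes any two components comparable.

Hence h_r(z) is the number of classes of divisors of z modulo B_r.  Each class
has exactly one element x that is maximal, i.e. such that x sigma_i does not
divide z for i < r.  Deleting the last entry of the normal form of such an x
shows that they are counted by the sequences (s_1, ..., s_d, Delta_r) with
normal consecutive pairs.  Reading the maximal elements for r = n-1 in
increasing order gives a word drawn in the graph with h_(n-1)(z) - 1 letters
sigma_(n-1). *)

Local Open Scope group_scope.
Implicit Types x y z : posbraid.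

(** * The lcm of two generators *)

Definition plen x : nat := size (repr x).
Definition letters x : {pred nat} := [pred i | i \in repr x].

Lemma pcls_repr x : pcls (repr x) = x.
Proof. exact: cls_repr. Qed.

Lemma pcls_cons i u : pcls (i :: u) = sigma i * pcls u.
Proof. by rewrite -[i :: u]/([:: i] ++ u) /pcls clsM. Qed.

Lemma pcls_cat u v : pcls (u ++ v) = pcls u * pcls v.
Proof. by rewrite /pcls clsM. Qed.

Lemma plen_pcls u : plen (pcls u) = size u.
Proof. by apply/cong_artin_size/clsP/cls_repr. Qed.

Lemma letters_pcls u i : (i \in letters (pcls u)) = (i \in u).
Proof. by rewrite inE; apply/cong_artin_mem/clsP/cls_repr. Qed.

Lemma plenM x y : plen (x * y) = (plen x + plen y)%N.
Proof.
by rewrite -(pcls_repr x) -(pcls_repr y) -pcls_cat !plen_pcls size_cat.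
Qed.

Lemma lettersM x y i :
  (i \in letters (x * y)) = (i \in letters x) || (i \in letters y).
Proof.
by rewrite -(pcls_repr x) -(pcls_repr y) -pcls_cat !letters_pcls mem_cat.
Qed.

Lemma plen1 : plen 1 = 0%N.
Proof. exact: (plen_pcls [::]). Qed.

Lemma plen_sigma i : plen (sigma i) = 1%N.
Proof. exact: plen_pcls. Qed.

Lemma letters_sigma i j : (j \in letters (sigma i)) = (j == i).
Proof. by rewrite letters_pcls inE. Qed.

Lemma letters1 j : (j \in letters 1) = false.
Proof. exact: (letters_pcls [::]). Qed.

Lemma posbraid_ind (P : posbraid -> Prop) :
  P 1 -> (forall i x, P x -> P (sigma i * x)) -> forall x, P x.
Proof.
move=> P1 PS x; rewrite -(pcls_repr x).
by elim: (repr x) => [|i u IH] //; rewrite pcls_cons; apply: PS.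
Qed.

Lemma posbraid_case x : x = 1 \/ exists i y, x = sigma i * y.
Proof.
by elim/posbraid_ind: x => [|i x _]; [left|right; exists i, x].
Qed.

Lemma plen_eq0 x : plen x = 0%N -> x = 1.
Proof.
by case: (posbraid_case x) => [//|[i [y ->]]]; rewrite plenM plen_sigma.
Qed.

Lemma sigma_neq1 i : sigma i <> 1.
Proof. by move/(congr1 plen); rewrite plen1 plen_sigma. Qed.

Definition far (i j : nat) : bool := (i.+2 <= j)%N || (j.+2 <= i)%N.
Definition near (i j : nat) : bool := (i.+1 == j) || (j.+1 == i).

Lemma far_sym i j : far i j = far j i.
Proof. by rewrite /far orbC. Qed.

Lemma near_sym i j : near i j = near j i.
Proof. by rewrite /near orbC. Qed.

Variant letter_dist i j : Prop :=
  | LetterEq of i = j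
  | LetterFar of far i j
  | LetterNear of near i j.

Lemma letter_distP i j : letter_dist i j.
Proof.
have : [\/ i = j, far i j | near i j].
  rewrite /far /near.
  by have := ltngtP i j => -[h|h|h]; [| |by constructor 1];
    have [h'|h'] := eqVneq i.+1 j; have [h''|h''] := eqVneq j.+1 i;
    first [constructor 3; lia|constructor 2; lia].
by case=> h; [constructor 1|constructor 2|constructor 3].
Qed.

Lemma far_comm i j : far i j -> sigma i * sigma j = sigma j * sigma i.
Proof.
move=> h; rewrite /sigma -!pcls_cat.
by apply/clsP; apply: (cong_rel [::] [::] (artin_far h)).
Qed.

Lemma near_braid i j : near i j ->
  sigma i * sigma j * sigma i = sigma j * sigma i * sigma j.
Proof.
move=> h; rewrite /sigma -!pcls_cat.
by apply/clsP; apply: (cong_rel [::] [::] (artin_near h)).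
Qed.

Lemma far_commA i j x : far i j ->
  sigma i * (sigma j * x) = sigma j * (sigma i * x).
Proof. by move=> h; rewrite !mulgA far_comm. Qed.

Lemma near_braidA i j x : near i j ->
  sigma i * (sigma j * (sigma i * x)) = sigma j * (sigma i * (sigma j * x)).
Proof. by move=> h; rewrite !mulgA near_braid. Qed.

(** The Artin relations are stable under reversal of words, so this is an anti-automorphism; it
    carries results on left divisors over to right divisors. *)
Definition pbrev x : posbraid := pcls (rev (repr x)).

Lemma cong_rev u v : cong artin u v -> cong artin (rev u) (rev v).
Proof.
elim=> {u v} [u v a b ab|u|u v _ IH|u v w _ IH _ IH'].
- rewrite !rev_cat -!catA; apply: cong_rel.
  case: ab => i j h /=; last exact: artin_near.
  by apply: artin_far; rewrite orbC.
- exact: cong_refl.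
- exact: cong_sym.
- exact: cong_trans IH IH'.
Qed.

Lemma pbrev_pcls u : pbrev (pcls u) = pcls (rev u).
Proof. by apply/clsP/cong_rev/clsP/cls_repr. Qed.

Lemma pbrevK : involutive pbrev.
Proof. by move=> x; rewrite -(pcls_repr x) !pbrev_pcls revK. Qed.

Lemma pbrevM x y : pbrev (x * y) = pbrev y * pbrev x.
Proof.
rewrite -(pcls_repr x) -(pcls_repr y) -pcls_cat !pbrev_pcls rev_cat.
exact: pcls_cat.
Qed.

Lemma pbrev_sigma i : pbrev (sigma i) = sigma i.
Proof. exact: pbrev_pcls. Qed.

(* [scompl i j] is the element written i\j: sigma_i (i\j) is the right lcm of
   sigma_i and sigma_j. *)
Definition scompl (i j : nat) : posbraid :=
  if i == j then 1 else if far i j then sigma j else sigma j * sigma i.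

Lemma scompl_id i : scompl i i = 1.
Proof. by rewrite /scompl eqxx. Qed.

Lemma far_neq i j : far i j -> (i == j) = false.
Proof. by rewrite /far; lia. Qed.

Lemma near_neq i j : near i j -> (i == j) = false.
Proof. by rewrite /near; lia. Qed.

Lemma near_nfar i j : near i j -> far i j = false.
Proof. by rewrite /near /far; lia. Qed.

Lemma scompl_far i j : far i j -> scompl i j = sigma j.
Proof. by move=> h; rewrite /scompl far_neq // h. Qed.

Lemma scompl_near i j : near i j -> scompl i j = sigma j * sigma i.
Proof. by move=> h; rewrite /scompl near_neq // near_nfar. Qed.

Lemma scomplE i j : sigma i * scompl i j = sigma j * scompl j i.
Proof.
case: (letter_distP i j) => [->|h|h]; first by [].
  by rewrite !scompl_far // 1?far_sym // far_comm.
by rewrite !scompl_near // 1?near_sym // !mulgA near_braid.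
Qed.

(** Garside's lcm property of two generators, with left cancellation as the case [i = j]; the length
    bound prepares an induction. *)
Definition key_at (n : nat) : Prop := forall i j x y,
  (plen x <= n)%N -> sigma i * x = sigma j * y ->
  exists z, x = scompl i j * z /\ y = scompl j i * z.

Lemma key_cancel n i x y : key_at n -> (plen x <= n)%N ->
  sigma i * x = sigma i * y -> x = y.
Proof.
by move=> K xn /(K _ _ _ _ xn) [z]; rewrite scompl_id mul1g => -[-> ->].
Qed.


Lemma key_far n i j x y : key_at n -> (plen x <= n)%N -> far i j ->
  sigma i * x = sigma j * y ->
  exists z, x = sigma j * z /\ y = sigma i * z.
Proof.
move=> K xn ij /(K _ _ _ _ xn) [z]; have ji : far j i by rewrite far_sym.
by rewrite (scompl_far ij) (scompl_far ji); exists z.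
Qed.

Lemma key_near n i j x y : key_at n -> (plen x <= n)%N -> near i j ->
  sigma i * x = sigma j * y ->
  exists z, x = sigma j * (sigma i * z) /\ y = sigma i * (sigma j * z).
Proof.
move=> K xn ij /(K _ _ _ _ xn) [z]; have ji : near j i by rewrite near_sym.
by rewrite (scompl_near ij) (scompl_near ji) -!mulgA; exists z.
Qed.

Lemma plen_sM i x : plen (sigma i * x) = (plen x).+1.
Proof. by rewrite plenM plen_sigma. Qed.

Section CubeCondition.
Variable n : nat.
Hypothesis K : forall m, (m < n)%N -> key_at m.
Variables (i j k : nat).

(** The equation says, after cancelling sigma_k, that the lcm of sigma_i and sigma_k times [z1]
    equals the lcm of sigma_k and sigma_j times [z2]. The cases below run over the relative
    positions of the three letters and use the lcm property for shorter elements only. *)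
Let cube (z1 z2 : posbraid) : Prop :=
  (plen (scompl k i * z1)%g <= n)%N ->
  scompl k i * z1 = scompl k j * z2 ->
  exists z, scompl i k * z1 = scompl i j * z /\ scompl j k * z2 = scompl j i * z.

Let Kfar a b x y : (plen x < n)%N -> far a b -> sigma a * x = sigma b * y ->
  exists z, x = sigma b * z /\ y = sigma a * z.
Proof. by move=> /K /key_far; apply. Qed.

Let Knear a b x y : (plen x < n)%N -> near a b -> sigma a * x = sigma b * y ->
  exists z, x = sigma b * (sigma a * z) /\ y = sigma a * (sigma b * z).
Proof. by move=> /K /key_near; apply. Qed.

Let Kcancel a x y : (plen x < n)%N -> sigma a * x = sigma a * y -> x = y.
Proof. by move=> /K /key_cancel; apply. Qed.

Lemma cube_same z1 z2 : i = j -> cube z1 z2.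
Proof.
move=> ji; rewrite /cube -ji => zn e; exists (scompl i k * z1).
rewrite scompl_id !mul1g; split=> //.
congr (_ * _); symmetry; move: zn e.
case: (letter_distP k i) => [->|ki|ki]; first by rewrite scompl_id !mul1g.
  by rewrite scompl_far // plen_sM => zn; apply: Kcancel.
rewrite scompl_near // -!mulgA !plen_sM => zn e.
by apply: (@Kcancel k); [lia|apply: (@Kcancel i) e; rewrite plen_sM; lia].
Qed.

Lemma cube_far_far z1 z2 : i != j -> far k i -> far k j -> cube z1 z2.
Proof.
move=> ij ki kj; have ik : far i k by rewrite far_sym.
have jk : far j k by rewrite far_sym.
rewrite /cube (scompl_far ki) (scompl_far kj) (scompl_far ik) (scompl_far jk).
rewrite plen_sM => zn e.
have [z [-> ->]] := K zn (leqnn _) e.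
exists (sigma k * z); split;
  rewrite /scompl 1?[j == i]eq_sym (negPf ij) 1?[far j i]far_sym;
  by case: ifP => _; rewrite -?mulgA 1?(far_commA _ ki) 1?(far_commA _ kj)
     1?(far_commA _ ki).
Qed.

Lemma cube_near_far z1 z2 : i != j -> near k i -> far k j -> cube z1 z2.
Proof.
move=> ij ki kj; have ik : near i k by rewrite near_sym.
have jk : far j k by rewrite far_sym.
rewrite /cube (scompl_near ki) (scompl_far kj) (scompl_near ik) (scompl_far jk).
rewrite -!mulgA !plen_sM => zn.
case: (letter_distP i j) => [e|ijf|ijn]; first by rewrite e eqxx in ij.
  case/Kfar; rewrite ?plen_sM //; try lia.
  move=> t [] /Kfar[] //; try lia.
  move=> s [-> ->] ->; have ji : far j i by rewrite far_sym.
  rewrite (scompl_far ijf) (scompl_far ji).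
  exists (sigma k * (sigma i * s)).
  by rewrite (far_commA _ ijf) (far_commA _ kj) near_braidA.
case/Knear; rewrite ?plen_sM //; try lia.
move=> t [] e ->.
case/Kfar: (e) => // [|s [z1E]]; try lia.
have := congr1 plen e; rewrite !plen_sM => et.
case/Knear; [lia|by rewrite near_sym|] => p [tE sE].
have ji : near j i by rewrite near_sym.
rewrite z1E sE tE (scompl_near ijn) (scompl_near ji).
exists (sigma k * (sigma i * (sigma j * p))); rewrite -!mulgA; split.
  rewrite (near_braidA _ ijn) (far_commA _ kj) (far_commA p jk).
  by rewrite (near_braidA _ ki).
by rewrite (far_commA _ jk) (near_braidA _ ki) (near_braidA _ ijn) (far_commA _ kj).
Qed.

Lemma cube_near_near z1 z2 : i != j -> near k i -> near k j -> cube z1 z2.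
Proof.
move=> ij ki kj; have ijf : far i j by move: ij ki kj; rewrite /near /far; lia.
have ik : near i k by rewrite near_sym.
have jk : near j k by rewrite near_sym.
have ji : far j i by rewrite far_sym.
rewrite /cube !(scompl_near ki) !(scompl_near kj) !(scompl_near ik).
rewrite !(scompl_near jk) !scompl_far // -!mulgA !plen_sM => zn e0.
case/Kfar: (e0); rewrite ?plen_sM //.
move=> t [e1 e2].
have := congr1 plen e0; have := congr1 plen e1; have := congr1 plen e2.
rewrite !plen_sM => l2 l1 l0.
case/Knear: e1 => //; try lia.
case/Knear: e2 => //; try lia.
move=> t2 [-> tE] t1 [-> tE'].
have := congr1 plen tE; have := congr1 plen tE'; rewrite !plen_sM => l3 l4.
have: sigma j * t1 = sigma i * t2.
  apply: (@Kcancel k); first by rewrite plen_sM; lia.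
  by rewrite -tE'.
case/Kfar => //; try lia.
move=> s [-> ->].
exists (sigma k * (sigma j * (sigma i * (sigma k * s)))); split.
  rewrite (far_commA (sigma k * (sigma i * s)) ijf).
  by rewrite (near_braidA _ ik) (near_braidA _ kj).
rewrite (far_commA (sigma k * (sigma j * s)) ji).
by rewrite (near_braidA _ jk) (near_braidA _ ki) (far_commA (sigma k * s) ijf).
Qed.

End CubeCondition.

(* Composing lcm squares of (i,k) and (k,j) yields one of (i,j). *)
Lemma key_trans n i j k x w y :
  (forall m, (m < n)%N -> key_at m) -> (plen w <= n)%N ->
  (exists z, x = scompl i k * z /\ w = scompl k i * z) ->
  (exists z, w = scompl k j * z /\ y = scompl j k * z) ->
  exists z, x = scompl i j * z /\ y = scompl j i * z.
Proof.
move=> K wn [z1 [-> wE]] [z2 [wE' ->]].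
have e : scompl k i * z1 = scompl k j * z2 by rewrite -wE.
have ln := wn; rewrite wE in ln; have ln' := wn; rewrite wE' in ln'.
have [ij|/eqP ij] := pselect (i = j); first exact: cube_same ij ln e.
have ji : j != i by rewrite eq_sym.
case: (letter_distP k i) => [ki|ki|ki].
- by exists z2; move: e; rewrite ki !scompl_id !mul1g => ->.
- case: (letter_distP k j) => [kj|kj|kj].
  + by exists z1; move: e; rewrite kj !scompl_id !mul1g => ->.
  + exact: (cube_far_far K) e.
  + by have [z [? ?]] := cube_near_far K ji kj ki ln' (esym e); exists z.
- case: (letter_distP k j) => [kj|kj|kj].
  + by exists z1; move: e; rewrite kj !scompl_id !mul1g => ->.
  + exact: (cube_near_far K) e.
  + exact: (cube_near_near K) e.
Qed.

(** Outer induction on the length, inner induction on a derivation between two words. A single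
    relation keeps the first letter or is itself the lcm square; at a transitivity step the first
    letter of the middle word gives two squares, which [key_trans] composes. *)
Lemma keyP n : key_at n.
Proof.
elim/ltn_ind: n => n K.
have H U V : cong artin U V -> (size U <= n.+1)%N -> forall i j u v,
    U = i :: u -> V = j :: v ->
    exists z, pcls u = scompl i j * z /\ pcls v = scompl j i * z.
  elim=> {U V} [u v a b ab|U|U V UV IH|U V W UV IH VW IH'] sU i j u' v'.
  - case: u sU => [|k u] /= sU; last first.
      case=> <- <- [<- <-]; exists (pcls (u ++ a ++ v)).
      rewrite !scompl_id !mul1g; split=> //.
      by apply/clsP/cong_sym/cong_rel.
    case: ab sU => {a b} k l kl _ /= [<- <-] [<- <-].
      have lk : far l k by rewrite far_sym.
      by exists (pcls v); rewrite (scompl_far kl) (scompl_far lk) -!pcls_cons.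
    have lk : near l k by rewrite near_sym.
    exists (pcls v); rewrite (scompl_near kl) (scompl_near lk).
    by rewrite !pcls_cons !mulgA.
  - by move=> -> [-> ->]; exists (pcls v'); rewrite scompl_id mul1g.
  - move=> VE UE; rewrite -(cong_artin_size UV) in sU.
    by have [z [? ?]] := IH sU j i v' u' UE VE; exists z.
  - move=> UE WE; have sz := cong_artin_size UV.
    case: V UV VW IH IH' sz => [|k w] UV VW IH IH' sz; first by rewrite UE in sz.
    apply: (@key_trans n i j k _ (pcls w) _ K).
    + by rewrite plen_pcls -ltnS -[_.+1]/(size (k :: w)) -sz.
    + exact: IH UE erefl.
    + by apply: IH' erefl WE; rewrite -sz.
move=> i j x y xn e.
have [] := H (i :: repr x) (j :: repr y) _ _ i j (repr x) (repr y) erefl erefl.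
- by apply/clsP; rewrite -!/(pcls _) !pcls_cons !pcls_repr.
- exact: xn.
by move=> z; rewrite !pcls_repr; exists z.
Qed.

(** * Cancellation, lcms and gcds *)

Lemma sigma_lcm i j x y : sigma i * x = sigma j * y ->
  exists z, x = scompl i j * z /\ y = scompl j i * z.
Proof. exact: (keyP (leqnn _)). Qed.

Lemma posbraid_mulgI x : injective (fun y : posbraid => x * y).
Proof.
elim/posbraid_ind: x => [|i x IH] y z /=; first by rewrite !mul1g.
by rewrite -!mulgA => /(key_cancel (@keyP _) (leqnn _)) /IH.
Qed.

Lemma posbraid_mulIg x : injective (fun y : posbraid => y * x).
Proof.
move=> y z /= /(congr1 pbrev); rewrite !pbrevM => /posbraid_mulgI.
exact: (can_inj pbrevK).
Qed.

Lemma posbraid_mulg_eq1 x y : x * y = 1 -> x = 1.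
Proof.
by move/(congr1 plen); rewrite plenM plen1 => e; apply: plen_eq0; lia.
Qed.

Lemma ldiv_refl x : ldiv x x.
Proof. by exists 1; rewrite mulg1. Qed.

Lemma ldiv1 x : ldiv 1 x.
Proof. by exists x; rewrite mul1g. Qed.

Lemma ldiv_mulr x y : ldiv x (x * y).
Proof. by exists y. Qed.

Lemma ldiv_trans y x z : ldiv x y -> ldiv y z -> ldiv x z.
Proof. by move=> [u ->] [v ->]; exists (u * v); rewrite mulgA. Qed.

Lemma ldiv_mul2l x y z : ldiv (x * y) (x * z) <-> ldiv y z.
Proof.
split=> -[t e]; exists t; last by rewrite e mulgA.
by apply: (@posbraid_mulgI x); rewrite e mulgA.
Qed.

Lemma ldivMl x y z : ldiv (x * y) z -> ldiv x z.
Proof. exact/ldiv_trans/ldiv_mulr. Qed.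

Lemma ldiv_plen x y : ldiv x y -> (plen x <= plen y)%N.
Proof. by move=> [t ->]; rewrite plenM leq_addr. Qed.

Lemma ldiv_eq x y : ldiv x y -> (plen y <= plen x)%N -> x = y.
Proof.
move=> [t ->]; rewrite plenM => h.
by rewrite (_ : t = 1) ?mulg1 //; apply: plen_eq0; lia.
Qed.

Lemma ldiv_anti x y : ldiv x y -> ldiv y x -> x = y.
Proof. by move=> xy /ldiv_plen; apply: ldiv_eq. Qed.

Lemma ldiv_letters x y i : ldiv x y -> i \in letters x -> i \in letters y.
Proof. by move=> [t ->] xi; rewrite lettersM xi. Qed.

Lemma ldiv_x1 x : ldiv x 1 -> x = 1.
Proof. by move=> [t /esym /posbraid_mulg_eq1]. Qed.

Definition is_lcm x y m : Prop :=
  [/\ ldiv x m, ldiv y m & forall z, ldiv x z -> ldiv y z -> ldiv m z].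

(** Induction on the length of the common multiple. First comes the lcm [l] of the two first
    letters; the lcms [m1] and [m2] of the tails with the complements extend it by [p] and [q], and
    the lcm [m3] of [p] and [q] closes the grid. *)
Lemma lcm_exists z x y : ldiv x z -> ldiv y z -> exists m, is_lcm x y m.
Proof.
have [n] := ubnP (plen z); elim: n => // n IH in x y z *; rewrite ltnS => zn.
case: (posbraid_case x) => [->|[i [x' ->]]] xz yz.
  by exists y; split=> //; [apply: ldiv1|apply: ldiv_refl].
case: (posbraid_case y) yz => [->|[j [y' ->]]] yz.
  by exists (sigma i * x'); split=> //; [apply: ldiv_refl|apply: ldiv1].
have lcmij w a b : ldiv (sigma i * a) w -> ldiv (sigma j * b) w ->
    ldiv (sigma i * scompl i j) w.
  move=> [t ->] [s]; rewrite -!mulgA => /sigma_lcm [r [-> _]].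
  by rewrite mulgA; apply: ldiv_mulr.
set l := sigma i * scompl i j in lcmij.
have le : l = sigma j * scompl j i by apply: scomplE.
have lz := lcmij _ _ _ xz yz.
have [m1 [xm1 lm1 m1P]] : exists m, is_lcm x' (scompl i j) m.
  have [z1 zE] := ldivMl xz; rewrite zE plen_sM in zn.
  by apply: (IH _ _ z1); [lia| |]; apply/(ldiv_mul2l (sigma i)); rewrite -zE.
have [m2 [ym2 lm2 m2P]] : exists m, is_lcm y' (scompl j i) m.
  have [z2 zE] := ldivMl yz; rewrite zE plen_sM in zn.
  apply: (IH _ _ z2); [lia| |]; apply/(ldiv_mul2l (sigma j)); rewrite -zE //.
  by rewrite -le.
have [p pE] : ldiv l (sigma i * m1) by apply/ldiv_mul2l.
have [q qE] : ldiv l (sigma j * m2) by rewrite le; apply/ldiv_mul2l.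
have m1z w : ldiv (sigma i * x') w -> ldiv l w -> ldiv (sigma i * m1) w.
  move=> xw lw; have [w1 wE] := ldivMl xw; move: xw lw; rewrite wE /l.
  by rewrite !ldiv_mul2l; apply: m1P.
have m2z w : ldiv (sigma j * y') w -> ldiv l w -> ldiv (sigma j * m2) w.
  move=> yw lw; have [w1 wE] := ldivMl yw; move: yw lw; rewrite wE le.
  by rewrite !ldiv_mul2l; apply: m2P.
have [c zE] := lz.
have pc : ldiv p c by apply/(ldiv_mul2l l); rewrite -pE -zE; apply: m1z.
have qc : ldiv q c by apply/(ldiv_mul2l l); rewrite -qE -zE; apply: m2z.
have [m3 [pm qm m3P]] : exists m, is_lcm p q m.
  by apply: (IH _ _ c) => //; move: zn; rewrite zE plenM /l plen_sM; lia.
exists (l * m3); split.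
- apply: (@ldiv_trans (sigma i * m1)); first by apply/ldiv_mul2l.
  by rewrite pE; apply/ldiv_mul2l.
- apply: (@ldiv_trans (sigma j * m2)); first by apply/ldiv_mul2l.
  by rewrite qE; apply/ldiv_mul2l.
move=> w xw yw; have lw := lcmij _ _ _ xw yw.
have [v wE] := lw; rewrite wE; apply/ldiv_mul2l/m3P.
  by apply/(ldiv_mul2l l); rewrite -pE -wE; apply: m1z.
by apply/(ldiv_mul2l l); rewrite -qE -wE; apply: m2z.
Qed.

Lemma ex_max_prop (P : nat -> Prop) k b : P k -> (forall n, P n -> (n <= b)%N) ->
  exists2 m, P m & forall n, P n -> (n <= m)%N.
Proof.
move=> Pk Pb; have ex : exists n, (fun n => `[< P n >]) n by exists k; apply/asboolP.
have ub n : `[< P n >] -> (n <= b)%N by move/asboolP/Pb.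
case: (ex_maxnP ex ub) => m /asboolP Pm mP; exists m => // n Pn.
by apply: mP; apply/asboolP.
Qed.

Definition gcd_of x y g : Prop :=
  [/\ ldiv g x, ldiv g y & forall g', ldiv g' x -> ldiv g' y -> ldiv g' g].

(** A longest common divisor is the gcd: its lcm with any other common divisor is again a common
    divisor, hence not longer. *)
Lemma gcd_exists x y : exists g, gcd_of x y g.
Proof.
have [||m [g [gx gy <-]] gP] := @ex_max_prop
  (fun n => exists g, [/\ ldiv g x, ldiv g y & plen g = n]) 0 (plen x).
- by exists 1; split; [exact: ldiv1|exact: ldiv1|exact: plen1].
- by move=> n [g [/ldiv_plen gx _ <-]].
exists g; split=> // g' gx' gy'.
have [l [gl gl' lP]] := lcm_exists gx gx'.
suff -> : g = l by [].
by apply: ldiv_eq => //; apply: gP; exists l; split=> //; apply: lP.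
Qed.

Definition rdiv x y : Prop := exists t, y = t * x.

Lemma rdiv_pbrev x y : rdiv x y <-> ldiv (pbrev x) (pbrev y).
Proof.
split=> -[t]; first by move=> ->; exists (pbrev t); rewrite pbrevM.
by move/(congr1 pbrev); rewrite pbrevM !pbrevK => ->; exists (pbrev t).
Qed.

Lemma llcm_exists z x y : rdiv x z -> rdiv y z ->
  exists m, [/\ rdiv x m, rdiv y m & forall w, rdiv x w -> rdiv y w -> rdiv m w].
Proof.
rewrite !rdiv_pbrev => xz yz; have [m [xm ym mP]] := lcm_exists xz yz.
exists (pbrev m); split=> [||w]; rewrite !rdiv_pbrev pbrevK //.
exact: mP.
Qed.

(** The left lcm of [e] and [f] divides [s * f = c * e] on the right, and the cofactor [k] is a
    common left divisor of [s] and [c], hence trivial. *)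
Lemma coprime_llcm s c f e w : s * f = c * e ->
    (forall g, ldiv g s -> ldiv g c -> g = 1) ->
  rdiv e w -> rdiv f w -> rdiv (s * f) w.
Proof.
move=> sf cop ew fw.
have [||m [[p mp] [q mq] mP]] := @llcm_exists (s * f) e f.
- by exists c.
- by exists s.
have [k kE] : rdiv m (s * f) by apply: mP; [exists c|exists s].
have ck : c = k * p by apply: (@posbraid_mulIg e); rewrite -sf kE mp mulgA.
have sk : s = k * q by apply: (@posbraid_mulIg f); rewrite kE mq mulgA.
have k1 : k = 1 by apply: cop; rewrite ?ck ?sk; apply: ldiv_mulr.
by rewrite kE k1 mul1g; apply: mP.
Qed.

(** * The Garside elements *)

Lemma prod_sigma s : \big[*%g/1]_(i <- s) sigma i = pcls s.
Proof.
by elim: s => [|i s IH]; rewrite ?big_nil // big_cons IH pcls_cons.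
Qed.

Lemma Delta_recl n : Delta n.+1 = pcls (iota 0 n) * Delta n.
Proof.
by rewrite /= -prod_sigma -(big_mkord xpredT) /index_iota subn0.
Qed.

Lemma Delta_recr_pcls n : Delta n.+1 = Delta n * pcls (rev (iota 0 n)).
Proof. by rewrite Delta_recr prod_sigma. Qed.

Lemma Delta1 : Delta 1 = 1.
Proof. by rewrite Delta_recl mulg1. Qed.

Lemma pcls_iotaS n : pcls (iota 0 n.+1) = pcls (iota 0 n) * sigma n.
Proof. by rewrite -[n.+1]addn1 iotaD pcls_cat. Qed.

Lemma commute_pcls i u : (forall j, j \in u -> far i j) -> 
  sigma i * pcls u = pcls u * sigma i.
Proof.
elim: u => [|j u IH] h; first by rewrite mulg1 mul1g.
rewrite pcls_cons far_commA; last by apply: h; rewrite mem_head.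
by rewrite IH ?mulgA // => k ku; apply: h; rewrite inE ku orbT.
Qed.

Lemma sigma_iota n i : (i.+1 < n)%N ->
  sigma i.+1 * pcls (iota 0 n) = pcls (iota 0 n) * sigma i.
Proof.
elim: n => // n IH; rewrite ltnS leq_eqVlt => /orP[/eqP <-|lin].
  rewrite !pcls_iotaS !mulgA commute_pcls; last first.
    by move=> j; rewrite mem_iota /far; lia.
  by rewrite -!mulgA [sigma i.+1 * _]mulgA near_braid ?mulgA // /near; lia.
rewrite pcls_iotaS mulgA IH // -!mulgA far_comm // /far; lia.
Qed.

Lemma sigma_rev_iota n i : (i.+1 < n)%N ->
  sigma i * pcls (rev (iota 0 n)) = pcls (rev (iota 0 n)) * sigma i.+1.
Proof.
move=> /sigma_iota /(congr1 pbrev).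
by rewrite !pbrevM !pbrev_sigma !pbrev_pcls => ->.
Qed.

(** Conjugation by [Delta n] flips the generators. A letter [i.+1] moves through the left recursion
    of [Delta], which lowers its index; the letter 0 needs the right recursion. *)
Lemma sigma_Delta n i : (i.+1 < n)%N ->
  sigma i * Delta n = Delta n * sigma (n - i.+2)%N.
Proof.
elim: n i => // n IH [|i]; rewrite ltnS; last first.
  move=> lin; rewrite Delta_recl mulgA sigma_iota // -!mulgA IH //.
case: n IH => // -[|n] IH _.
  have -> : Delta 2 = sigma 0 by rewrite Delta_recl Delta1 mulg1.
  by [].
have h : ((n.+2 - 2).+1 < n.+2)%N by lia.
have := IH 0 isT; rewrite (Delta_recr_pcls n.+2); move: (Delta n.+2) => D e.
rewrite mulgA e -!mulgA (sigma_rev_iota h).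
by congr (_ * (_ * sigma _)); lia.
Qed.

Definition bounded_by (n : nat) x : Prop :=
  forall i, i \in letters x -> (i.+1 < n)%N.

Lemma in_BnP n x : in_Bn n x <-> bounded_by n x.
Proof.
split=> [[u -> /allP un] i|xn]; first by rewrite letters_pcls => /un.
by exists (repr x); [rewrite pcls_repr|apply/allP].
Qed.

Lemma bounded1 n : bounded_by n 1.
Proof. by move=> i; rewrite letters1. Qed.

Lemma boundedM n x y :
  bounded_by n (x * y) <-> bounded_by n x /\ bounded_by n y.
Proof.
split=> [h|[hx hy] i]; last by rewrite lettersM => /orP[/hx|/hy].
by split=> i hi; apply: h; rewrite lettersM hi ?orbT.
Qed.

Lemma bounded_sigma n i : bounded_by n (sigma i) <-> (i.+1 < n)%N.
Proof.
split=> [|h j]; first by apply; rewrite letters_sigma.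
by rewrite letters_sigma => /eqP ->.
Qed.

Lemma bounded_ldiv n x y : ldiv x y -> bounded_by n y -> bounded_by n x.
Proof. by move=> [t ->] /boundedM []. Qed.

Lemma bounded_Delta n k : bounded_by n (Delta n ^+ k).
Proof.
elim: k => [|k IH]; first exact: bounded1.
rewrite expgS; apply/boundedM; split=> // {IH k}.
elim: n => [|[|n] IH]; [exact: bounded1|by rewrite Delta1; exact: bounded1|].
rewrite Delta_recl; apply/boundedM; split=> i; last by move/IH; lia.
by rewrite letters_pcls mem_iota; lia.
Qed.

Lemma sigma_ldiv_Delta n i : (i.+1 < n)%N -> ldiv (sigma i) (Delta n).
Proof.
elim: n => // n IH; rewrite ltnS leq_eqVlt => /orP[/eqP <-|/IH [t e]]; last first.
  by exists (t * pcls (rev (iota 0 n))); rewrite Delta_recr_pcls e mulgA.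
(* The new letter [i] is the flip of 0, and [sigma 0] is the last letter in the right recursion. *)
have [c e] : rdiv (sigma 0) (Delta i.+2).
  by rewrite Delta_recr_pcls rev_cons -cats1 pcls_cat mulgA; eexists.
exists c; apply: (@posbraid_mulIg (sigma 0)).
by rewrite /= -(mulgA (sigma i)) -e (sigma_Delta (ltnSn i.+1)) subnn.
Qed.

Lemma conj_Delta1 n x : bounded_by n x ->
  exists2 y, bounded_by n y & x * Delta n = Delta n * y.
Proof.
elim/posbraid_ind: x => [|i x IH] xn; first by exists 1; rewrite ?mul1g ?mulg1.
have [/bounded_sigma i_n /IH [y yn e]] := (boundedM _ _ _).1 xn.
exists (sigma (n - i.+2)%N * y); last by rewrite -mulgA e !mulgA sigma_Delta.
by apply/boundedM; split=> //; apply/bounded_sigma; lia.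
Qed.

Lemma conj_Delta n k x : bounded_by n x ->
  exists2 y, bounded_by n y & x * Delta n ^+ k = Delta n ^+ k * y.
Proof.
elim: k => [|k IH] in x *; first by exists x; rewrite ?mul1g ?mulg1.
move=> /conj_Delta1 [y /IH [z zn e'] e]; exists z => //.
by rewrite expgS mulgA e -!mulgA e'.
Qed.

Lemma conj_Delta_r1 n x : bounded_by n x ->
  exists2 y, bounded_by n y & Delta n * x = y * Delta n.
Proof.
elim/posbraid_ind: x => [|i x IH] xn; first by exists 1; rewrite ?mul1g ?mulg1.
have [/bounded_sigma i_n /IH [y yn e]] := (boundedM _ _ _).1 xn.
exists (sigma (n - i.+2)%N * y).
  by apply/boundedM; split=> //; apply/bounded_sigma; lia.
have h : ((n - i.+2).+1 < n)%N by lia.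
rewrite -(mulgA (sigma _)) -e !mulgA (sigma_Delta h).
by congr (_ * sigma _ * _); lia.
Qed.

Lemma conj_Delta_r n k x : bounded_by n x ->
  exists2 y, bounded_by n y & Delta n ^+ k * x = y * Delta n ^+ k.
Proof.
elim: k => [|k IH] in x *; first by exists x; rewrite ?mul1g ?mulg1.
move=> /IH [y /conj_Delta_r1 [z zn e'] e]; exists z => //.
by rewrite expgS -mulgA e mulgA e' mulgA.
Qed.

(** With D the power of Delta, x D = D x' = x y x', and cancelling x leaves D = y x'; the other half
    is symmetric. *)
Lemma ldiv_rdiv_Delta n k x y : x * y = Delta n ^+ k ->
  ldiv y (Delta n ^+ k) /\ rdiv x (Delta n ^+ k).
Proof.
move=> e; have := @bounded_Delta n k; rewrite -e => /boundedM [xn yn].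
have [x' _ ex] := conj_Delta k xn; have [y' _ ey] := conj_Delta_r k yn.
split.
  exists x'; apply: (@posbraid_mulgI x).
  by rewrite /= (mulgA x y) e.
exists y'; apply: (@posbraid_mulIg y).
by rewrite /= -(mulgA y') e.
Qed.

Lemma sigma_Delta_pow n k i : (i.+1 < n)%N ->
  exists2 j, (j.+1 < n)%N & sigma i * Delta n ^+ k = Delta n ^+ k * sigma j.
Proof.
elim: k => [|k IH] in i *; first by exists i; rewrite ?mul1g ?mulg1.
move=> ni; have h : ((n - i.+2).+1 < n)%N by lia.
have [j nj e] := IH _ h; exists j => //.
by rewrite expgS mulgA sigma_Delta // -!(mulgA (Delta n)) e.
Qed.

Lemma bounded_ldiv_Delta n x : bounded_by n x ->
  exists k, ldiv x (Delta n ^+ k).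
Proof.
elim/posbraid_ind: x => [|i x IH] xn; first by exists 0; apply: ldiv1.
have [/bounded_sigma i_n /IH [k kP]] := (boundedM _ _ _).1 xn.
have [j nj e] := sigma_Delta_pow k i_n.
exists k.+1; apply: (@ldiv_trans (sigma i * Delta n ^+ k)).
  exact/ldiv_mul2l.
by rewrite e expgSr; apply/ldiv_mul2l/sigma_ldiv_Delta.
Qed.

(* Writing [Delta n ^+ k = x * c] and [s * f = c * e] for the right lcm of s and
   c, [s * f] is also the left lcm of e and f.  As e is simple, it divides on the
   right [Delta n * f], which is a common left multiple of Delta n and f; cancel
   f. *)
Lemma gcd_tail_simple n k x s : ldiv (x * s) (Delta n ^+ k.+1) ->
  gcd_of (x * s) (Delta n ^+ k) x -> ldiv s (Delta n).
Proof.
move=> xs [_ [c ec] xP].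
have cop g : ldiv g s -> ldiv g c -> g = 1.
  move=> gs gc; apply: ldiv_x1; apply/(ldiv_mul2l x); rewrite mulg1.
  by apply: xP; rewrite ?ec; apply/ldiv_mul2l.
have xc : ldiv (x * c) (Delta n ^+ k.+1) by rewrite -ec expgSr; apply: ldiv_mulr.
have [w ew] := ldivMl xs.
move: xs xc; rewrite ew !ldiv_mul2l => sw cw.
have [l [[f ef] [e ee] lP]] := lcm_exists sw cw.
have eD : ldiv e (Delta n).
  apply/(ldiv_mul2l (Delta n ^+ k)); rewrite -expgSr ew ec -mulgA -ee.
  by apply/ldiv_mul2l/lP.
have [e' eE] := eD.
have [_ [u uE]] : ldiv e' (Delta n ^+ 1) /\ rdiv e (Delta n ^+ 1).
  by apply: ldiv_rdiv_Delta; rewrite eE.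
have fn : bounded_by n f.
  have : bounded_by n (x * (s * f)).
    apply: bounded_ldiv (@bounded_Delta n k.+1).
    by rewrite ew -ef; apply/ldiv_mul2l/lP.
  by move=> /boundedM [_ /boundedM []].
have [f' _ fE] := conj_Delta_r1 fn.
have [p pE] : rdiv (s * f) (Delta n * f).
  apply: (@coprime_llcm s c f e _ _ cop).
  - by rewrite -ef ee.
  - by exists (f' * u); rewrite fE -mulgA -uE.
  - by exists (Delta n).
have : p * s = Delta n ^+ 1.
  by apply: (@posbraid_mulIg f); rewrite -mulgA -pE.
by move=> /ldiv_rdiv_Delta [].
Qed.

(** * Property A *)

Section Dynnikov.

Local Open Scope Z_scope.

(* Dynnikov's action of sigma_i and of its inverse on the coordinates of integral
   laminations of the punctured disk. *)
Definition dyn_pos (p q : Z * Z) : (Z * Z) * (Z * Z) :=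
  let z := p.1 - Z.min p.2 0 - q.1 + Z.max q.2 0 in
  ((p.1 + Z.max p.2 0 + Z.max (Z.max q.2 0 - z) 0, q.2 - Z.max z 0),
   (q.1 + Z.min q.2 0 + Z.min (Z.min p.2 0 + z) 0, p.2 + Z.max z 0)).

Definition dyn_neg (p q : Z * Z) : (Z * Z) * (Z * Z) :=
  let z := p.1 + Z.min p.2 0 - q.1 - Z.max q.2 0 in
  ((p.1 - Z.max p.2 0 - Z.max (Z.max q.2 0 + z) 0, q.2 + Z.min z 0),
   (q.1 - Z.min q.2 0 - Z.min (Z.min p.2 0 - z) 0, p.2 - Z.min z 0)).

Ltac split_sign a :=
  let H := fresh in
  first
    [ assert (H : 0 <= a) by lia;
      rewrite ?(Z.max_l a 0 H) ?(Z.min_r a 0 H)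
    | assert (H : a <= 0) by lia;
      rewrite ?(Z.max_r a 0 H) ?(Z.min_l a 0 H)
    | destruct (Z.le_ge_cases a 0) as [H|H];
      [ rewrite ?(Z.max_r a 0 H) ?(Z.min_l a 0 H)
      | rewrite ?(Z.max_l a 0 H) ?(Z.min_r a 0 H) ] ].

(* Splits on the sign of the innermost arguments first, so that [lia] can prune
   the impossible sign patterns. *)
Ltac split_signs := repeat
  match goal with
  | |- context [Z.max ?a 0] =>
    lazymatch a with
    | context [Z.max _ _] => fail | context [Z.min _ _] => fail
    | _ => split_sign a end
  | |- context [Z.min ?a 0] =>
    lazymatch a with
    | context [Z.max _ _] => fail | context [Z.min _ _] => fail
    | _ => split_sign a end
  end.

Lemma dyn_posK p q : let r := dyn_pos p q in dyn_neg r.1 r.2 = (p, q).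
Proof.
case: p q => [x1 y1] [x2 y2]; rewrite /dyn_neg /dyn_pos /=.
by congr (_, _, (_, _)); split_signs; lia.
Qed.

Lemma dyn_negK p q : let r := dyn_neg p q in dyn_pos r.1 r.2 = (p, q).
Proof.
case: p q => [x1 y1] [x2 y2]; rewrite /dyn_neg /dyn_pos /=.
by congr (_, _, (_, _)); split_signs; lia.
Qed.

Lemma dyn_braid p q r :
  let a := dyn_pos p q in let b := dyn_pos a.2 r in let c := dyn_pos a.1 b.1 in
  let a' := dyn_pos q r in let b' := dyn_pos p a'.1 in
  let c' := dyn_pos b'.2 a'.2 in
  [/\ c.1 = b'.1, c.2 = c'.1 & b.2 = c'.2].
Proof.
case: p q r => [x1 y1] [x2 y2] [x3 y3]; cbv zeta; unfold dyn_pos.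
cbv beta zeta; cbn [fst snd].
have and6 (T : Type) (a b c d e f a' b' c' d' e' f' : T) :
    a = a' /\ b = b' /\ c = c' /\ d = d' /\ e = e' /\ f = f' ->
  [/\ (a, b) = (a', b'), (c, d) = (c', d') & (e, f) = (e', f')].
  by case=> -> [-> [-> [-> [-> ->]]]].
apply: and6; split_signs; lia.
Qed.

Definition dyn_state := nat -> Z * Z.

Definition dyn_letter (l : nat * bool) (f : dyn_state) : dyn_state :=
  let r := (if l.2 then dyn_pos else dyn_neg) (f l.1) (f l.1.+1) in
  fun k => if k == l.1 then r.1 else if k == l.1.+1 then r.2 else f k.

Definition dyn_word (w : bword) (f : dyn_state) : dyn_state :=
  foldl (fun f l => dyn_letter l f) f w.

Lemma dyn_word_cat u v f : dyn_word (u ++ v) f = dyn_word v (dyn_word u f).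
Proof. exact: foldl_cat. Qed.

End Dynnikov.

Section DynnikovAction.
Implicit Types (f : dyn_state) (i j k m : nat).

Lemma dyn_letterl i b f : dyn_letter (i, b) f i =
  ((if b then dyn_pos else dyn_neg) (f i) (f i.+1)).1.
Proof. by rewrite /dyn_letter /= eqxx. Qed.

Lemma dyn_letterr i b f : dyn_letter (i, b) f i.+1 =
  ((if b then dyn_pos else dyn_neg) (f i) (f i.+1)).2.
Proof. by rewrite /dyn_letter /= eqxx gtn_eqF. Qed.

Lemma dyn_letter_out i b f k : k != i -> k != i.+1 ->
  dyn_letter (i, b) f k = f k.
Proof. by rewrite /dyn_letter /= => /negPf -> /negPf ->. Qed.

Lemma dyn_letterK i b f : dyn_letter (i, ~~ b) (dyn_letter (i, b) f) = f.
Proof.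
apply/funext => k.
have H : let r := (if b then dyn_pos else dyn_neg) (f i) (f i.+1) in
    (if ~~ b then dyn_pos else dyn_neg) r.1 r.2 = (f i, f i.+1).
  by case: b; [exact: dyn_posK|exact: dyn_negK].
have [->|ki] := eqVneq k i; first by rewrite !dyn_letterl dyn_letterr H.
have [->|ki1] := eqVneq k i.+1; first by rewrite !dyn_letterr dyn_letterl H.
by rewrite !dyn_letter_out.
Qed.

Lemma dyn_letter_far i j f : far i j ->
  dyn_letter (j, true) (dyn_letter (i, true) f) =
  dyn_letter (i, true) (dyn_letter (j, true) f).
Proof.
move=> ij; apply/funext => k.
have oi b g : dyn_letter (j, b) g i = g i.
  by apply: dyn_letter_out; move: ij; rewrite /far; lia.
have oi1 b g : dyn_letter (j, b) g i.+1 = g i.+1.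
  by apply: dyn_letter_out; move: ij; rewrite /far; lia.
have oj b g : dyn_letter (i, b) g j = g j.
  by apply: dyn_letter_out; move: ij; rewrite /far; lia.
have oj1 b g : dyn_letter (i, b) g j.+1 = g j.+1.
  by apply: dyn_letter_out; move: ij; rewrite /far; lia.
have [->|kj] := eqVneq k j; first by rewrite !(dyn_letterl, oj, oj1).
have [->|kj1] := eqVneq k j.+1; first by rewrite !(dyn_letterr, oj, oj1).
have [->|ki] := eqVneq k i; first by rewrite !(dyn_letterl, oi, oi1).
have [->|ki1] := eqVneq k i.+1; first by rewrite !(dyn_letterr, oi, oi1).
by rewrite !dyn_letter_out.
Qed.

Lemma dyn_letter_near i f :
  dyn_letter (i, true) (dyn_letter (i.+1, true) (dyn_letter (i, true) f)) =
  dyn_letter (i.+1, true) (dyn_letter (i, true) (dyn_letter (i.+1, true) f)).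
Proof.
have o0 g : dyn_letter (i.+1, true) g i = g i by apply: dyn_letter_out; lia.
have o2 g : dyn_letter (i, true) g i.+2 = g i.+2 by apply: dyn_letter_out; lia.
have := dyn_braid (f i) (f i.+1) (f i.+2); cbv zeta => -[e1 e2 e3].
have E := (o0, o2, dyn_letterl, dyn_letterr).
apply/funext => k.
have [->|k0] := eqVneq k i; first by rewrite !E e1.
have [->|k1] := eqVneq k i.+1; first by rewrite !E e2.
have [->|k2] := eqVneq k i.+2; first by rewrite !E e3.
by rewrite !dyn_letter_out.
Qed.

Lemma dyn_word_cong u v : cong artin_grp u v -> dyn_word u = dyn_word v.
Proof.
elim=> {u v} [u v a b ab|//|u v _ -> //|u v w _ -> _ -> //].
apply/funext => f; rewrite !dyn_word_cat; congr dyn_word.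
move: (dyn_word u f) => {}f; case: ab => {a b} [a b [i j|i j]|i b].
- by move=> ij; rewrite /dyn_word /= dyn_letter_far.
- by move=> /orP[] /eqP <-; rewrite /dyn_word /= dyn_letter_near.
- by rewrite /dyn_word /= dyn_letterK.
Qed.

(** This monotonicity is what detects positivity: a positive letter never raises the first entry of
    its right-hand pair, and lowers it when the second entry is negative. *)
Lemma dyn_pos_le p q : Z.le (dyn_pos p q).2.1 q.1.
Proof. by rewrite /dyn_pos /=; lia. Qed.

Lemma dyn_pos_lt p q : Z.lt q.2 0 -> Z.lt (dyn_pos p q).2.1 q.1.
Proof. by rewrite /dyn_pos /=; lia. Qed.

Lemma dyn_word_low (w : bword) m f : (forall l, l \in w -> (l.1 < m)%N) ->
  dyn_word w f m.+1 = f m.+1.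
Proof.
elim: w f => //= -[i b] w IH f h.
rewrite /dyn_word /= -/(dyn_word w _) IH => [|l lw]; last first.
  by apply: h; rewrite inE lw orbT.
have := h _ (mem_head _ _) => /= im.
by rewrite dyn_letter_out //; lia.
Qed.

Lemma dyn_word_le (w : bword) m f :
    (forall l, l \in w -> (l.1 <= m)%N) -> (m, false) \notin w ->
  Z.le (dyn_word w f m.+1).1 (f m.+1).1.
Proof.
elim: w f => [|l w IH] f h; first by move=> _; apply: Z.le_refl.
rewrite inE negb_or => /andP[lm wm].
have hw l' : l' \in w -> (l'.1 <= m)%N by move=> lw; apply: h; rewrite inE lw orbT.
apply: Z.le_trans (IH (dyn_letter l f) hw wm) _.
have := h _ (mem_head _ _); case: l lm {h} => i b /= ib im.
have [im'|im'] := eqVneq i m; last first.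
  by rewrite dyn_letter_out; [exact: Z.le_refl| |]; lia.
subst i; case: b ib => //; last by rewrite eqxx.
by move=> _; rewrite dyn_letterr; apply: dyn_pos_le.
Qed.

(** Letters below [m] leave the pair [m.+1] alone, so the first sigma_m still meets the negative
    second entry and lowers the first one; [dyn_word_le] covers the rest of the word. *)
Lemma dyn_word_lt (w : bword) m f :
    (forall l, l \in w -> (l.1 <= m)%N) -> (m, false) \notin w ->
    (m, true) \in w -> Z.lt (f m.+1).2 0 ->
  Z.lt (dyn_word w f m.+1).1 (f m.+1).1.
Proof.
elim: w f => // l w IH f h.
rewrite inE negb_or => /andP[lm wm] mw f0.
have hw l' : l' \in w -> (l'.1 <= m)%N by move=> lw; apply: h; rewrite inE lw orbT.
have := h _ (mem_head _ _); case: l lm mw {h} => i b /= ib mw im.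
have [im'|im'] := eqVneq i m; last first.
  have o : dyn_letter (i, b) f m.+1 = f m.+1 by rewrite dyn_letter_out //; lia.
  rewrite -o; apply: IH => //; last by rewrite o.
  by move: mw; rewrite inE => /orP[/eqP[e]|//]; rewrite e eqxx in im'.
subst i; case: b ib mw => ib mw; last by rewrite eqxx in ib.
apply: (Z.le_lt_trans _ (dyn_letter (m, true) f m.+1).1); first exact: dyn_word_le.
by rewrite dyn_letterr; apply: dyn_pos_lt.
Qed.

End DynnikovAction.

(* The base point (0,-1) makes the first letter sigma_m strictly decrease the
   first entry of the pair m.+1; the other letters of w never increase it, and
   those of v do not touch it. *)
Lemma sigma_positive_neq (w v : bword) m :
    (forall l, l \in w -> (l.1 <= m)%N) -> (m, false) \notin w ->
    (m, true) \in w -> (forall l, l \in v -> (l.1 < m)%N) ->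
  bcls w <> bcls v.
Proof.
move=> wm mf mt vm /clsP /dyn_word_cong e.
have := @dyn_word_lt w m (fun=> (Z0, Zneg xH)) wm mf mt.
have lt0 : Z.lt (Zneg xH) Z0 by [].
by move=> /(_ lt0); rewrite e dyn_word_low //=; lia.
Qed.

(** * Paths in the divisor graph *)

Section Comparability.
Variables (T : Type) (conn up edge : T -> T -> Prop) (N : T -> nat).

Let cmp a b := [\/ conn a b, up a b | up b a].

Hypothesis conn_sym : forall a b, conn a b -> conn b a.
Hypothesis conn_trans : forall a b c, conn a b -> conn b c -> conn a c.
Hypothesis up_connl : forall a b c, conn a b -> up b c -> up a c.
Hypothesis up_connr : forall a b c, up a b -> conn b c -> up a c.
Hypothesis up_trans : forall a b c, up a b -> up b c -> up a c.
Hypothesis edge_up : forall a b, edge a b -> up a b.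
Hypothesis up_edge : forall a b, up a b ->
  exists2 a1, edge a a1 & conn a1 b \/ up a1 b.
Hypothesis diamond : forall a b c, edge a b -> edge a c -> cmp b c.
Hypothesis N_up : forall a b, up a b -> (N b < N a)%N.

(** A confluence argument as in Newman's lemma. The diamond compares the ends [b1] and [c1] of the
    first edges; if, say, [c1] is above [b1], then [c] is also above [b1], where the measure [N] is
    smaller and the induction applies. *)
Lemma common_bound_cmp a b c : up a b -> up a c -> cmp b c.
Proof.
have [n] := ubnP (N a); elim: n => // n IH in a b c *; rewrite ltnS => an.
move=> /up_edge [b1 ab1 b1b] /up_edge [c1 ac1 c1c].
have IHb d e : up b1 d -> up b1 e -> cmp d e.
  by apply: IH; apply: leq_trans (N_up (edge_up ab1)) an.
have IHc d e : up c1 d -> up c1 e -> cmp d e.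
  by apply: IH; apply: leq_trans (N_up (edge_up ac1)) an.
have [bc|bc|bc] := diamond ab1 ac1.
- case: b1b c1c => [b1b|b1b] [c1c|c1c].
  + constructor 1; apply: conn_trans c1c; apply: conn_trans bc.
    exact: conn_sym.
  + constructor 2; apply: up_connl c1c; apply: conn_trans bc.
    exact: conn_sym.
  + constructor 3; apply: up_connl b1b; apply: conn_trans (conn_sym bc).
    exact: conn_sym.
  + by apply: IHb => //; apply: up_connl c1c.
- have b1c : up b1 c by case: c1c; [exact: up_connr|exact: up_trans].
  case: b1b => [b1b|b1b]; last exact: IHb.
  by constructor 2; apply: up_connl b1c; apply: conn_sym.
- have c1b : up c1 b by case: b1b; [exact: up_connr|exact: up_trans].
  case: c1c => [c1c|c1c]; last exact: IHc.
  by constructor 3; apply: up_connl c1b; apply: conn_sym.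
Qed.

End Comparability.

(** Any common multiple of two generators is a multiple of their lcm, so the whole lcm square based
    at [x] stays among the divisors of [z]. *)
Lemma ldiv_far x z i j : far i j ->
  ldiv (x * sigma i) z -> ldiv (x * sigma j) z ->
  ldiv (x * (sigma i * sigma j)) z.
Proof.
move=> ij [t ->] [s]; rewrite -!mulgA => /posbraid_mulgI /sigma_lcm [r [-> _]].
by rewrite (scompl_far ij) ldiv_mul2l !mulgA; apply: ldiv_mulr.
Qed.

Lemma ldiv_near x z i j : near i j ->
  ldiv (x * sigma i) z -> ldiv (x * sigma j) z ->
  ldiv (x * (sigma i * (sigma j * sigma i))) z.
Proof.
move=> ij [t ->] [s]; rewrite -!mulgA => /posbraid_mulgI /sigma_lcm [r [-> _]].
by rewrite (scompl_near ij) ldiv_mul2l !mulgA; apply: ldiv_mulr.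
Qed.

Lemma sigma_llcm i j x y : x * sigma i = y * sigma j ->
  exists z, x = z * pbrev (scompl i j) /\ y = z * pbrev (scompl j i).
Proof.
move/(congr1 pbrev); rewrite !pbrevM !pbrev_sigma => /sigma_lcm [z [ex ey]].
by exists (pbrev z); rewrite -!pbrevM -ex -ey !pbrevK.
Qed.

Lemma sigma_llcm_far i j x y : far i j -> x * sigma i = y * sigma j ->
  exists2 z, x = z * sigma j & y = z * sigma i.
Proof.
move=> ij /sigma_llcm [z]; have ji : far j i by rewrite far_sym.
by rewrite (scompl_far ij) (scompl_far ji) !pbrev_sigma => -[-> ->]; exists z.
Qed.

Lemma sigma_llcm_near i j x y : near i j -> x * sigma i = y * sigma j ->
  exists2 z, x = z * (sigma i * sigma j) & y = z * (sigma j * sigma i).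
Proof.
move=> ij /sigma_llcm [z]; have ji : near j i by rewrite near_sym.
rewrite (scompl_near ij) (scompl_near ji) !pbrevM !pbrev_sigma => -[-> ->].
by exists z.
Qed.

Lemma to_braidM x y : to_braid (x * y) = to_braid x * to_braid y.
Proof. exact: to_braid_monoid_morphism.2. Qed.

Section Paths.
Variable z : posbraid.

Definition edge (l : nat * bool) x y : Prop :=
  [/\ ldiv x z, ldiv y z &
      if l.2 then y = x * sigma l.1 else x = y * sigma l.1].

Fixpoint gpath x (w : bword) y : Prop :=
  if w is l :: w' then exists2 x', edge l x x' & gpath x' w' y
  else ldiv x z /\ x = y.

Lemma gpath_Div x w y : gpath x w y -> ldiv x z /\ ldiv y z.
Proof.
by elim: w x => [|l w IH] x /= => [[xz <-]|[x' [xz _ _] /IH []]].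
Qed.

Lemma gpath_cat x u v y :
  gpath x (u ++ v) y <-> exists2 t, gpath x u t & gpath t v y.
Proof.
elim: u x => [|l u IH] x /=.
  split=> [xy|[t [_ <-]] //]; exists x => //; split=> //.
  by have [] := gpath_Div xy.
split=> [[x' e /IH [t x't ty]]|[t [x' e] xt ty]].
  by exists t => //; exists x'.
by exists x' => //; apply/IH; exists t.
Qed.

Lemma edge_sym i b x y : edge (i, b) x y -> edge (i, ~~ b) y x.
Proof. by case: b => -[]; split. Qed.

Lemma gpath_inv x w y : gpath x w y -> gpath y (inv_word w) x.
Proof.
elim: w x => [|[i b] w IH] x; first by case=> xz <-; split.
case=> x' e /IH x'y; rewrite /inv_word map_cons rev_cons -cats1.
apply/gpath_cat; exists x' => //=; exists x; first exact: (@edge_sym i b).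
by case: e.
Qed.

Lemma bcls_cat u v : bcls (u ++ v) = bcls u * bcls v.
Proof. exact: clsM. Qed.

Lemma to_braid_sigma i : to_braid (sigma i) = bcls [:: (i, true)].
Proof. exact: to_braid_cls. Qed.

Lemma bcls_letter i b : bcls [:: (i, b)] * bcls [:: (i, ~~ b)] = 1.
Proof.
rewrite -bcls_cat; apply/clsP.
exact: (cong_rel [::] [::] (artin_grp_inv i b)).
Qed.

Lemma edge_to_braid l x y : edge l x y -> to_braid y = to_braid x * bcls [:: l].
Proof.
case: l => i [] [_ _ /= ->]; rewrite to_braidM to_braid_sigma //.
by rewrite -mulgA bcls_letter mulg1.
Qed.

Lemma gpath_to_braid x w y : gpath x w y -> to_braid y = to_braid x * bcls w.
Proof.
elim: w x => [|l w IH] x /=; first by move=> [_ ->]; rewrite mulg1.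
move=> [x' /edge_to_braid e /IH ->].
by rewrite e -[l :: w]/([:: l] ++ w) bcls_cat mulgA.
Qed.

Lemma gpath_drawn x w y : gpath x w y -> drawn z x w.
Proof.
move=> p v /prefixP [u e]; move: p; rewrite e => /gpath_cat [t xt _].
by exists t; [have [] := gpath_Div xt|rewrite (gpath_to_braid xt)].
Qed.

Definition letters_lt (m : nat) (w : bword) : bool := all (fun l => l.1 < m)%N w.

Lemma letters_lt_cat m u v :
  letters_lt m (u ++ v) = letters_lt m u && letters_lt m v.
Proof. exact: all_cat. Qed.

Lemma letters_lt_inv m w : letters_lt m (inv_word w) = letters_lt m w.
Proof. by rewrite /letters_lt /inv_word all_rev all_map. Qed.

Lemma letters_ltW m w : letters_lt m w -> letters_lt m.+1 w.
Proof. by apply: sub_all => l /ltnW. Qed.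

Lemma mem_inv_word i b w : ((i, b) \in inv_word w) = ((i, ~~ b) \in w).
Proof.
rewrite /inv_word mem_rev; apply/mapP/idP => [[[j c] lw [-> ->]]|lw].
  by rewrite negbK.
by exists (i, ~~ b); rewrite //= negbK.
Qed.

Lemma letters_lt_notin m b w : letters_lt m w -> (m, b) \notin w.
Proof. by move=> /allP h; apply/negP => /h /=; rewrite ltnn. Qed.

(** Letters are numbered from 0, so those below [m] generate B_(m+1); hence the level [r.-1] for
    classes modulo B_r. *)
Definition conn (m : nat) x y : Prop := exists2 w, letters_lt m w & gpath x w y.

Definition pos_word_of (m : nat) (w : bword) : Prop :=
  [/\ letters_lt m.+1 w, (m, false) \notin w & (m, true) \in w].

Definition up (m : nat) x y : Prop := exists2 w, pos_word_of m w & gpath x w y.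

Definition cmp (m : nat) x y : Prop := [\/ conn m x y, up m x y | up m y x].

Lemma conn_refl m x : ldiv x z -> conn m x x.
Proof. by exists [::]. Qed.

Lemma conn_sym m x y : conn m x y -> conn m y x.
Proof.
by case=> w wm /gpath_inv p; exists (inv_word w); rewrite ?letters_lt_inv.
Qed.

Lemma conn_trans m x y t : conn m x y -> conn m y t -> conn m x t.
Proof.
move=> [u um p] [v vm q]; exists (u ++ v); first by rewrite letters_lt_cat um.
by apply/gpath_cat; exists y.
Qed.

Lemma up_connl m x y t : conn m x y -> up m y t -> up m x t.
Proof.
move=> [u um p] [v [vm vf vt] q]; exists (u ++ v).
  split; rewrite ?letters_lt_cat ?mem_cat ?vt ?orbT ?negb_or //.
    by rewrite letters_ltW.
  by rewrite letters_lt_notin.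
by apply/gpath_cat; exists y.
Qed.

Lemma up_connr m x y t : up m x y -> conn m y t -> up m x t.
Proof.
move=> [v [vm vf vt] q] [u um p]; exists (v ++ u).
  split; rewrite ?letters_lt_cat ?mem_cat ?vt ?orbT ?negb_or ?vm ?vf //=.
    by rewrite letters_ltW.
  by rewrite letters_lt_notin.
by apply/gpath_cat; exists y.
Qed.

Lemma up_trans m x y t : up m x y -> up m y t -> up m x t.
Proof.
move=> [v [vm vf vt] q] [u [um uf ut] p]; exists (v ++ u).
  by split; rewrite ?letters_lt_cat ?mem_cat ?vt ?orbT ?negb_or ?vm ?vf.
by apply/gpath_cat; exists y.
Qed.

(** Property A in the graph: both paths would represent the quotient of [y] by [x]. *)
Lemma up_nconn m x y : up m x y -> ~ conn m x y.
Proof.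
move=> [w [wm wf wt] p] [v vm q].
have /(@sigma_positive_neq w v m) : forall l, l \in w -> (l.1 <= m)%N.
  by move/allP: wm.
move=> /(_ wf wt); apply; first by move/allP: vm.
apply: (@mulgI _ (to_braid x)).
by rewrite -(gpath_to_braid p) -(gpath_to_braid q).
Qed.

Lemma conn0 x y : conn 0 x y -> x = y.
Proof. by case=> -[|l w] //= _ []. Qed.

(** The edges sigma_m of the quotient graph whose vertices are the components for the letters below
    [m]. *)
Definition crossing (m : nat) x y : Prop :=
  exists t, [/\ conn m x t, conn m (t * sigma m) y & ldiv (t * sigma m) z].

Lemma edge_pos t i : ldiv (t * sigma i) z -> edge (i, true) t (t * sigma i).
Proof. by split=> //; apply: ldivMl; eauto. Qed.

Lemma edge_neg t i : ldiv (t * sigma i) z -> edge (i, false) (t * sigma i) t.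
Proof. by split=> //; apply: ldivMl; eauto. Qed.

Lemma crossing_up m x y : crossing m x y -> up m x y.
Proof.
move=> [t [xt ty tz]]; apply: up_connl xt _; apply: up_connr ty.
exists [:: (m, true)].
  by split; rewrite /letters_lt /= ?inE ?xpair_eqE ?andbF ?eqxx ?ltnSn.
by exists (t * sigma m); [exact: edge_pos|].
Qed.

Lemma up_first m x y : up m x y ->
  exists2 x1, crossing m x x1 & conn m x1 y \/ up m x1 y.
Proof.
move=> [w [wm wf wt] p]; elim: w x wm wf wt p => // -[i b] w IH x /=.
move=> /andP[/= im wm]; rewrite inE negb_or => /andP[ib wf] wt [x' e p].
have x'z : ldiv x' z by case: e.
have [im'|im'] := eqVneq i m; last first.
  have xx' : conn m x x'.
    by exists [:: (i, b)]; [rewrite /= andbT; lia|exists x'].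
  have wt' : (m, true) \in w.
    by move: wt; rewrite inE => /orP[/eqP[ei]|//]; rewrite ei eqxx in im'.
  have [x1 [t [xt tx1 tz]] x1y] := IH x' wm wf wt' p.
  by exists x1 => //; exists t; split=> //; apply: conn_trans xx' xt.
subst i; case: b ib wt e => ib wt e; last by rewrite eqxx in ib.
case: e => xz _ /= ex'.
exists x'; first by exists x; rewrite -ex'; split=> //; apply: conn_refl.
case: (boolP ((m, true) \in w)) => wt'; [right|left]; exists w => //.
apply/allP => -[i b] lw; have /allP/(_ _ lw) /= := wm.
rewrite ltnS leq_eqVlt => /orP[/eqP ei|//]; subst i.
by case: b lw => lw; rewrite lw in wt' wf.
Qed.

Lemma up_last m x y : up m x y ->
  exists2 y1, crossing m y1 y & conn m x y1 \/ up m x y1.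
Proof.
move=> [w [wm wf wt] p]; elim/last_ind: w y wm wf wt p => // w [i b] IH y.
rewrite -cats1 letters_lt_cat /= mem_cat negb_or inE.
move=> /andP[wm /andP[im _]] /andP[wf ib] wt /gpath_cat [x' p [y' e [_ ey]]].
subst y'.
have x'z : ldiv x' z by case: e.
have [im'|im'] := eqVneq i m; last first.
  have x'y : conn m x' y.
    by exists [:: (i, b)]; [rewrite /= andbT; lia|exists y => //; case: e].
  have wt' : (m, true) \in w.
    move: wt; rewrite mem_cat inE => /orP[//|/eqP[ei]].
    by rewrite ei eqxx in im'.
  have [y1 [t [xt tx1 tz]] x1y] := IH x' wm wf wt' p.
  by exists y1 => //; exists t; split=> //; apply: conn_trans tx1 x'y.
subst i; case: b ib wt e => ib wt e; last by rewrite eqxx in ib.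
case: e => _ yz /= ey.
exists x'.
  by exists x'; rewrite -ey; split=> //; apply: conn_refl.
case: (boolP ((m, true) \in w)) => wt'; [right|left]; exists w => //.
apply/allP => -[i b] lw; have /allP/(_ _ lw) /= := wm.
rewrite ltnS leq_eqVlt => /orP[/eqP ei|//]; subst i.
by case: b lw => lw; rewrite lw in wt' wf.
Qed.

Definition up_set m x := [set y | ldiv y z /\ up m x y]%classic.
Definition down_set m x := [set y | ldiv y z /\ up m y x]%classic.

End Paths.

(** * Comparability of the divisors *)

Lemma card_fset_set_lt (T : choiceType) (A B : set T) t :
    finite_set B -> (A `<=` B)%classic -> B t -> ~ A t ->
  (#|` fset_set A| < #|` fset_set B|)%N.
Proof.
move=> finB AB Bt At; have finA := sub_finite_set AB finB.
apply: fproper_ltn_card; rewrite fproperE; apply/andP; split.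
  by apply/fsubsetP => x; rewrite !in_fset_set // !inE; apply: AB.
apply/negP => /fsubsetP /(_ t); rewrite !in_fset_set // !inE.
by move=> /(_ Bt).
Qed.

Section PropertyC.
Variable z : posbraid.
Local Notation edge := (edge z).
Local Notation gpath := (gpath z).
Local Notation conn := (conn z).
Local Notation up := (up z).
Local Notation cmp := (cmp z).
Local Notation crossing := (crossing z).

Lemma edge_slide_out i j b x y : far i j -> edge (i, b) x y ->
  ldiv (x * sigma j) z -> edge (i, b) (x * sigma j) (y * sigma j).
Proof.
move=> ij; case: b => -[/= xz yz e] xj; rewrite e in xz yz xj *.
  have h := ldiv_far ij yz xj; have c := far_comm ij.
  split=> //=; last by rewrite -!mulgA c.
  by rewrite -mulgA.
split=> //=; last by rewrite -!mulgA far_comm.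
by apply: (@ldivMl _ (sigma i)); rewrite -mulgA -far_comm // mulgA.
Qed.

(* A path that is sigma_m-positive is pushed across sigma_{m+1} by means of
   s_{m+1}^-1 s_m s_{m+1} = s_m s_{m+1} s_m^-1. *)
Lemma slide_out m x w x' :
    letters_lt m.+1 w -> (m, false) \notin w -> gpath x w x' ->
    ldiv (x * sigma m.+1) z ->
  exists2 w', gpath (x * sigma m.+1) w' (x' * sigma m.+1) &
    if (m, true) \in w then pos_word_of m.+1 w' else letters_lt m.+1 w'.
Proof.
elim: w x => [|[i b] w IH] x.
  by move=> _ _ [_ <-] xz; exists [::].
rewrite inE negb_or => /andP[/= im wm] /andP[ib wf] [x1 e p] xz.
have [im'|im'] := eqVneq i m; last first.
  have fi : far i m.+1 by rewrite /far; lia.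
  have e1 := edge_slide_out fi e xz.
  have [_ x1z _] := e1; have [w' p' w'P] := IH _ wm wf p x1z.
  exists ((i, b) :: w'); first by exists (x1 * sigma m.+1).
  rewrite inE xpair_eqE eq_sym (negPf im') /=.
  case: ifP w'P => _ => [[w'm w'f w't]|w'm]; last by rewrite /= im.
  split; rewrite /= ?w'm ?andbT ?inE ?xpair_eqE ?w't ?orbT ?negb_or ?w'f ?andbT //.
    lia.
  by lia.
subst i; case: b ib e => ib e; last by rewrite eqxx in ib.
have [_ x1z /= ex1] := e; rewrite ex1 in x1z.
have nm : near m m.+1 by rewrite /near; lia.
(* Both sigma_m and sigma_(m+1) lead from [x] to divisors of [z], so their lcm does too, and the
   detour below passes only through its divisors. *)
have h := ldiv_near nm x1z xz.
have x1mz : ldiv (x1 * sigma m.+1) z.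
  by rewrite ex1; apply: (@ldivMl _ (sigma m)); rewrite -!mulgA.
have [w' p' w'P] := IH _ wm wf p x1mz.
exists [:: (m, true), (m.+1, true), (m, false) & w'].
  have c := near_braid nm; rewrite -!mulgA in c.
  exists (x * sigma m.+1 * sigma m).
    apply: edge_pos; apply: (@ldivMl _ (sigma m.+1)).
    by rewrite -!mulgA -c.
  exists (x * sigma m.+1 * sigma m * sigma m.+1).
    by apply: edge_pos; rewrite -!mulgA -c.
  exists (x1 * sigma m.+1) => //.
  have -> : x * sigma m.+1 * sigma m * sigma m.+1 = x1 * sigma m.+1 * sigma m.
    by rewrite ex1 -!mulgA -c.
  by apply: edge_neg; rewrite ex1 -!mulgA.
rewrite mem_head; case: ifP w'P => _ => [[w'm w'f w't]|w'm].
  split; rewrite /= ?w'm ?inE ?xpair_eqE ?w't ?orbT ?negb_or ?w'f;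
    by rewrite ?andbT ?andbF //=; lia.
split; rewrite /= ?inE ?xpair_eqE ?eqxx ?orbT ?negb_or ?andbT ?andbF //=; try lia.
- by rewrite letters_ltW // andbT; lia.
- by rewrite letters_lt_notin //; lia.
Qed.

Definition neg_word_of m (w : bword) : Prop :=
  [/\ letters_lt m.+1 w, (m, true) \notin w & (m, false) \in w].

Lemma neg_word_of_inv m w : neg_word_of m (inv_word w) <-> pos_word_of m w.
Proof.
by split=> -[h1 h2 h3]; split; move: h1 h2 h3; rewrite ?letters_lt_inv ?mem_inv_word.
Qed.

(* By s_{m+1} s_m^-1 s_{m+1}^-1 = s_m^-1 s_{m+1}^-1 s_m. *)
Lemma slide_in m p w x' :
    letters_lt m.+1 w -> (m, true) \notin w -> gpath (p * sigma m.+1) w x' ->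
  exists p', x' = p' * sigma m.+1 /\
  exists2 w', gpath p w' p' &
    if (m, false) \in w then neg_word_of m.+1 w' else letters_lt m.+1 w'.
Proof.
elim: w p => [|[i b] w IH] p.
  move=> _ _ [pz <-]; exists p; split=> //; exists [::] => //.
  by split=> //; apply: ldivMl pz.
rewrite inE negb_or => /andP[/= im wm] /andP[ib wf] [x1 e pth].
have [xz x1z _] := e.
have [im'|im'] := eqVneq i m; last first.
  have fi : far i m.+1 by rewrite /far; lia.
  have [p1 ex1 e1] : exists2 p1, x1 = p1 * sigma m.+1 & edge (i, b) p p1.
    case: b ib e => ib [_ _ /= ex1].
      exists (p * sigma i); first by rewrite ex1 -!mulgA (far_comm fi).
      apply: edge_pos; apply: (@ldivMl _ (sigma m.+1)).
      by rewrite -mulgA (far_comm fi) mulgA -ex1.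
    have [q ex ep] := sigma_llcm_far fi (esym ex1); exists q => //.
    by rewrite ep; apply: edge_neg; rewrite -ep; apply: ldivMl xz.
  rewrite ex1 in pth; have [p' [ex' [w' p'' w'P]]] := IH _ wm wf pth.
  exists p'; split=> //; exists ((i, b) :: w'); first by exists p1.
  rewrite inE xpair_eqE eq_sym (negPf im') /=.
  case: ifP w'P => _ => [[w'm w'f w't]|w'm]; last by rewrite /= im.
  split; rewrite /= ?w'm ?andbT ?inE ?xpair_eqE ?w't ?orbT ?negb_or ?w'f ?andbT //.
    lia.
  by lia.
subst i; case: b ib e => ib e; first by rewrite eqxx in ib.
have nm : near m m.+1 by rewrite /near; lia.
have [_ _ /= ex] := e.
(* The left lcm gives p = q s_(m+1) s_m and x1 = q s_m s_(m+1); the detour descends from [p] to [q]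
   and climbs to q s_m, through divisors of [p] and [x1] only. *)
have [q ex1 ep] := sigma_llcm_near nm (esym ex).
have ex1' : x1 = q * sigma m * sigma m.+1 by rewrite ex1 mulgA.
rewrite ex1' in pth; have [p' [ex' [w' p'' w'P]]] := IH _ wm wf pth.
have pz : ldiv p z by apply: ldivMl xz.
exists p'; split=> //; exists [:: (m, false), (m.+1, false), (m, true) & w'].
  rewrite ep mulgA; rewrite ep mulgA in pz.
  exists (q * sigma m.+1); first exact: edge_neg.
  exists q; first by apply: edge_neg; apply: ldivMl pz.
  exists (q * sigma m) => //.
  by apply: edge_pos; apply: (@ldivMl _ (sigma m.+1)); rewrite -ex1'.
rewrite mem_head; case: ifP w'P => _ => [[w'm w'f w't]|w'm].
  split; rewrite /= ?w'm ?inE ?xpair_eqE ?w't ?orbT ?negb_or ?w'f;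
    by rewrite ?andbT ?andbF //=; lia.
split; rewrite /= ?inE ?xpair_eqE ?eqxx ?orbT ?negb_or ?andbT ?andbF //=; try lia.
- by rewrite letters_ltW // andbT; lia.
- by rewrite letters_lt_notin //; lia.
Qed.

(** Stated one level at a time, so that the diamonds for sigma_(m+1) may assume it for sigma_m. *)
Definition comparable_below (m : nat) : Prop :=
  forall x y, conn m.+1 x y -> cmp m x y.

Lemma cmp_sym m x y : cmp m x y -> cmp m y x.
Proof.
case=> h; [constructor 1; exact: conn_sym|by constructor 3|by constructor 2].
Qed.

Lemma cmp_connl m x y t : conn m x y -> cmp m y t -> cmp m x t.
Proof.
move=> xy [h|h|h]; [constructor 1|constructor 2|constructor 3].
- exact: conn_trans h.
- exact: up_connl h.
- by apply: up_connr h _; apply: conn_sym.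
Qed.

Lemma cmp_connr m x y t : cmp m x y -> conn m y t -> cmp m x t.
Proof.
by move=> xy yt; apply/cmp_sym/(cmp_connl (conn_sym yt))/cmp_sym.
Qed.

Lemma diamond_out0 m x y :
    (forall k, m = k.+1 -> comparable_below k) -> conn m x y ->
    ldiv (x * sigma m) z -> ldiv (y * sigma m) z ->
  cmp m (x * sigma m) (y * sigma m).
Proof.
case: m => [|m] C xy xz yz.
  by rewrite (conn0 xy); constructor 1; apply: conn_refl.
have H a b : ldiv (a * sigma m.+1) z -> conn m a b \/ up m a b ->
    cmp m.+1 (a * sigma m.+1) (b * sigma m.+1).
  move=> az [[w wm p]|[w [wm wf wt] p]].
    have [//||w' p'] := slide_out _ _ p az; first exact: letters_ltW.
      exact: letters_lt_notin.
    by rewrite (negPf (letters_lt_notin _ wm)) => w'm; constructor 1; exists w'.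
  have [w' p'] := slide_out wm wf p az.
  by rewrite wt => w'P; constructor 2; exists w'.
have [h|h|h] := C m erefl _ _ xy.
- by apply: H; [|left].
- by apply: H; [|right].
- by apply/cmp_sym; apply: H; [|right].
Qed.

(** Dual to [diamond_out0]. A path between the far ends is oriented to be sigma-negative, the sign
    that [slide_in] can carry back across the edges, and the result is inverted again. *)
Lemma diamond_in0 m x y :
    (forall k, m = k.+1 -> comparable_below k) ->
    conn m (x * sigma m) (y * sigma m) ->
  cmp m x y.
Proof.
case: m => [|m] C xy.
  have [w wm p] := xy; have [xz _] := gpath_Div p.
  rewrite (posbraid_mulIg (conn0 xy)); constructor 1.
  by rewrite -(posbraid_mulIg (conn0 xy)); apply: conn_refl; apply: ldivMl xz.
have H a b : conn m (a * sigma m.+1) (b * sigma m.+1) \/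
    up m (b * sigma m.+1) (a * sigma m.+1) -> cmp m.+1 a b.
  move=> [[w wm p]|[w wP p]].
    have [||b' [eb [w' p']]] := slide_in _ _ p; first exact: letters_ltW.
      exact: letters_lt_notin.
    rewrite (negPf (letters_lt_notin _ wm)) => w'm; constructor 1; exists w' => //.
    by rewrite (posbraid_mulIg eb).
  have [wm wt wf] := (neg_word_of_inv _ _).2 wP.
  have [b' [eb [w' p']]] := slide_in wm wt (gpath_inv p).
  rewrite wf -(posbraid_mulIg eb) in p' *.
  rewrite -{1}[w']inv_wordK => /neg_word_of_inv w'P.
  by constructor 3; exists (inv_word w') => //; apply: gpath_inv.
have [h|h|h] := C m erefl _ _ xy.
- by apply: H; left.
- by apply/cmp_sym; apply: H; right.
- by apply: H; right.
Qed.

Lemma up_irrefl m x : ~ up m x x.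
Proof.
move=> xx; apply: (up_nconn xx); apply: conn_refl.
by case: xx => w _ /gpath_Div [].
Qed.

Lemma up_Div m x y : up m x y -> ldiv x z /\ ldiv y z.
Proof. by case=> w _ /gpath_Div. Qed.

Lemma card_up_set m x y : up m x y ->
  (#|` fset_set (up_set z m y)| < #|` fset_set (up_set z m x)|)%N.
Proof.
move=> xy; apply: (@card_fset_set_lt _ _ _ y).
- by apply: sub_finite_set (finite_Div z) => t [].
- by move=> t [tz yt]; split=> //; apply: up_trans yt.
- by split=> //; case: (up_Div xy).
- by move=> [_ /up_irrefl].
Qed.

Lemma card_down_set m x y : up m y x ->
  (#|` fset_set (down_set z m y)| < #|` fset_set (down_set z m x)|)%N.
Proof.
move=> yx; apply: (@card_fset_set_lt _ _ _ y).
- by apply: sub_finite_set (finite_Div z) => t [].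
- by move=> t [tz ty]; split=> //; apply: up_trans ty yx.
- by split=> //; case: (up_Div yx).
- by move=> [_ /up_irrefl].
Qed.

(** Confluence upwards and downwards makes comparability at level [m] transitive. Each single letter
    of a path joins comparable elements, so the two ends are comparable. *)
Lemma comparable_belowP m : comparable_below m.
Proof.
elim/ltn_ind: m => m IH.
have {}IH k : m = k.+1 -> comparable_below k by move=> mk; apply: IH; rewrite mk.
have cmp_up a b c : up m a b -> up m a c -> cmp m b c.
  apply: (@common_bound_cmp _ (conn m) (up m) (crossing m)
            (fun x => #|` fset_set (up_set z m x)|)).
  - exact: conn_sym.
  - exact: conn_trans.
  - exact: up_connl.
  - exact: up_connr.
  - exact: up_trans.
  - exact: crossing_up.
  - exact: up_first.
  - move=> {}a {}b {}c [t [at_ tb tz]] [t' [at' t'c t'z]].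
    apply: cmp_connr t'c; apply: cmp_connl (conn_sym tb) _.
    by apply: diamond_out0 => //; apply: conn_trans at'; apply: conn_sym.
  - exact: card_up_set.
have cmp_down a b c : up m b a -> up m c a -> cmp m b c.
  move=> ba ca.
  (* The confluence lemma is applied to the opposite order, with [diamond_in0] as its diamond. *)
  suff [h|h|h] : [\/ conn m b c, up m c b | up m b c].
  - by constructor 1.
  - by constructor 3.
  - by constructor 2.
  apply: (@common_bound_cmp _ (conn m) (fun x y => up m y x)
            (fun x y => crossing m y x)
            (fun x => #|` fset_set (down_set z m x)|) _ _ _ _ _ _ _ _ _ a) => //.
  - exact: conn_sym.
  - exact: conn_trans.
  - by move=> ? ? ? xy /up_connr; apply; apply: conn_sym.
  - by move=> ? ? ? xy yz; apply: up_connl xy; apply: conn_sym.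
  - by move=> ? ? ? xy yz; apply: up_trans xy.
  - by move=> ? ?; apply: crossing_up.
  - move=> ? ? /up_last [y1 h1 h2]; exists y1 => //.
    by case: h2 => h2; [left; apply: conn_sym|right].
  - move=> {ba ca}a {}b {}c [t [at_ tb tz]] [t' [at' t'c t'z]].
    have : cmp m b c.
      apply: cmp_connl at_ _; apply: cmp_connr (conn_sym at').
      by apply: diamond_in0 => //; apply: conn_trans tb (conn_sym t'c).
    by case=> h; [constructor 1|constructor 3|constructor 2].
  - by move=> ? ?; apply: card_down_set.
have cmp_trans a b c : cmp m a b -> cmp m b c -> cmp m a c.
  case=> ab.
  - exact: cmp_connl.
  - case=> bc; last exact: cmp_down ab bc.
      by apply: cmp_connr bc; constructor 2.
    by constructor 2; apply: up_trans bc.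
  - case=> bc; first by apply: cmp_connr bc; constructor 3.
      exact: cmp_up ab bc.
    by constructor 3; apply: up_trans ab.
move=> x y [w wm p]; elim: w x wm p => [|[i b] w IHw] x.
  by move=> _ [xz <-]; constructor 1; apply: conn_refl.
move=> /andP[/= im wm] [x' e p]; apply: cmp_trans (IHw _ wm p).
have [_ x'z _] := e; move: im; rewrite ltnS leq_eqVlt => /orP[/eqP ei|im].
  subst i; case: b e => e; [constructor 2|constructor 3].
    exists [:: (m, true)]; last by exists x'.
    by split; rewrite /letters_lt /= ?inE ?xpair_eqE ?andbF ?eqxx ?ltnSn.
  exists [:: (m, true)]; last by exists x; [exact: (edge_sym e)|case: e].
  by split; rewrite /letters_lt /= ?inE ?xpair_eqE ?andbF ?eqxx ?ltnSn.
constructor 1; exists [:: (i, b)]; last by exists x'.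
by rewrite /letters_lt /= im.
Qed.

End PropertyC.

(** * Counting normal sequences *)

(* For t simple, these are the products s_1 * ... * s_d such that the sequence
   (s_1, ..., s_d, t) has normal consecutive pairs. *)
Definition maximal_for n d t : set posbraid :=
  [set x | ldiv x (Delta n ^+ d) /\
    forall u, ldiv u t -> ldiv (x * u) (Delta n ^+ d) -> u = 1]%classic.

Lemma finite_maximal_for n d t : finite_set (maximal_for n d t).
Proof. by apply: sub_finite_set (finite_Div (Delta n ^+ d)) => x []. Qed.

Definition normal_pair n s t : Prop :=
  forall u, ldiv u t -> ldiv (s * u) (Delta n) -> u = 1.

(** If [g] divides both [Delta n] and [s * t], its lcm with [s] has the form [s * u], where [u]
    divides [t] and [s * u] is simple; so [s] is the gcd as soon as every such [u] is trivial. *)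
Lemma normal_pairP n s t : ldiv s (Delta n) -> ldiv t (Delta n) ->
  normal_seq n [:: s; t] <-> normal_pair n s t.
Proof.
move=> sD tD.
have bD g : ldiv g (Delta n) -> in_Bn n g.
  by move=> gD; apply/in_BnP; apply: bounded_ldiv gD (@bounded_Delta n 1).
split=> [[_ /(_ 0 isT) [_ _ _ /= gP]] u ut su|st].
  apply: ldiv_x1; apply/(ldiv_mul2l s); rewrite mulg1; apply: gP => //.
    exact: bD.
  by rewrite !big_cons big_nil mulg1; apply/ldiv_mul2l.
split=> [x|]; first by rewrite !inE => /orP[] /eqP ->.
case=> [_|[_|//]]; rewrite /= ?drop0 !big_cons big_nil mulg1; split=> //.
- exact: bD.
- exact: ldiv_mulr.
- move=> g _ gD gst; have [l [gl [u su] lP]] := lcm_exists gD sD.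
  have : u = 1.
    apply: st; last by rewrite -su; apply: lP.
    by apply/(ldiv_mul2l s); rewrite -su; apply: lP => //; apply: ldiv_mulr.
  by move=> u1; move: gl; rewrite su u1 mulg1.
- exact: bD.
- exact: ldiv_refl.
Qed.

Lemma ldiv_mul_Delta n d x y : ldiv x (Delta n ^+ d) -> ldiv y (Delta n) ->
  ldiv (x * y) (Delta n ^+ d.+1).
Proof.
move=> [c ec] yD; apply: (@ldiv_trans (x * Delta n)); first exact/ldiv_mul2l.
have := @bounded_Delta n d; rewrite ec => /boundedM [_ /conj_Delta1 [c' _ e]].
by exists c'; rewrite expgSr ec -!mulgA e.
Qed.

Section Counting.
Variables (n d : nat).
Implicit Types s t u : posbraid.

(** Otherwise some [x1 * v] with [v] nontrivial divides both elements. The first letter of [v]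
    divides [s * u], hence [s], and extends [x1] inside the power of Delta, against maximality. *)
Lemma maximal_for_gcd s u x1 : ldiv s (Delta n) -> bounded_by n u ->
    (forall i, ldiv (sigma i) (Delta n) -> ldiv (sigma i) (s * u) ->
      ldiv (sigma i) s) ->
    maximal_for n d s x1 -> ldiv (x1 * (s * u)) (Delta n ^+ d.+1) ->
  gcd_of (x1 * (s * u)) (Delta n ^+ d) x1.
Proof.
move=> sD un su [x1D x1P] xD; split=> //; first exact: ldiv_mulr.
move=> g gx gD.
have [l [gl [v lv] lP]] := lcm_exists gx (ldiv_mulr x1 (s * u)).
have vsu : ldiv v (s * u).
  by apply/(ldiv_mul2l x1); rewrite -lv; apply: lP => //; apply: ldiv_mulr.
have x1v : ldiv (x1 * v) (Delta n ^+ d) by rewrite -lv; apply: lP.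
case: (posbraid_case v) => [v1|[i [v' ev]]].
  by move: gl; rewrite lv v1 mulg1.
have iv : ldiv (sigma i) v by rewrite ev; apply: ldiv_mulr.
have vn : bounded_by n v.
  by have := bounded_ldiv x1v (@bounded_Delta n d); move/boundedM => [].
have iD : ldiv (sigma i) (Delta n).
  apply: sigma_ldiv_Delta; apply: vn.
  by rewrite ev lettersM letters_sigma eqxx.
case: (@sigma_neq1 i); apply: x1P.
  by apply: su => //; apply: ldiv_trans iv vsu.
by apply: ldiv_trans x1v; apply/ldiv_mul2l.
Qed.

(** The lcm of sigma_i and [s] is [s * v] with [v] dividing [u], and it is simple, so normality
    forces [v = 1]. *)
Lemma normal_pair_sigma s t u i : ldiv s (Delta n) -> normal_pair n s t ->
  ldiv u t -> ldiv (sigma i) (Delta n) -> ldiv (sigma i) (s * u) ->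
  ldiv (sigma i) s.
Proof.
move=> sD st ut iD isu.
have [l [il [v lv] lP]] := lcm_exists iD sD.
have v1 : v = 1.
  apply: st; last by rewrite -lv; apply: lP.
  apply: ldiv_trans ut; apply/(ldiv_mul2l s); rewrite -lv.
  by apply: lP => //; apply: ldiv_mulr.
by move: il; rewrite lv v1 mulg1.
Qed.

(** Deletion of the last entry of the normal form: [x1] is the gcd with the lower power of Delta,
    and the remainder [s] is simple by [gcd_tail_simple]. An extension of [s] or of [x1] would
    contradict the maximality of [x] or that of the gcd. *)
Lemma maximal_for_split t x : ldiv t (Delta n) -> maximal_for n d.+1 t x ->
  exists x1 s, [/\ x = x1 * s, ldiv s (Delta n), normal_pair n s t,
    maximal_for n d s x1 & gcd_of x (Delta n ^+ d) x1].
Proof.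
move=> tD [xD xP]; have [x1 gx1] := gcd_exists x (Delta n ^+ d).
have [[s xs] x1D x1P] := gx1; exists x1, s.
have sD : ldiv s (Delta n) by apply: (@gcd_tail_simple n d x1); rewrite -xs.
split=> //.
  move=> u ut su; apply: xP => //; rewrite xs -mulgA.
  exact: ldiv_mul_Delta.
split=> // v vs x1v; apply: ldiv_x1; apply/(ldiv_mul2l x1); rewrite mulg1.
by apply: x1P => //; rewrite xs; apply/ldiv_mul2l.
Qed.

(** Inverse of the deletion. If [x1 * s * u] still divides the power of Delta, [x1] is also its gcd
    with the lower power, so [s * u] is simple and normality gives [u = 1]. *)
Lemma maximal_for_join t s x1 : ldiv t (Delta n) -> ldiv s (Delta n) ->
  normal_pair n s t -> maximal_for n d s x1 ->
  maximal_for n d.+1 t (x1 * s) /\ gcd_of (x1 * s) (Delta n ^+ d) x1.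
Proof.
move=> tD sD st mx1; have [x1D _] := mx1.
have G u : ldiv u t -> ldiv (x1 * (s * u)) (Delta n ^+ d.+1) ->
    gcd_of (x1 * (s * u)) (Delta n ^+ d) x1.
  move=> ut; apply: maximal_for_gcd => //.
    by apply: bounded_ldiv ut (bounded_ldiv tD (@bounded_Delta n 1)).
  by move=> i; apply: normal_pair_sigma st ut.
have x1s := ldiv_mul_Delta x1D sD; split; last first.
  by have := G 1 (ldiv1 t); rewrite mulg1; apply.
split=> // u ut; rewrite -mulgA => xD; apply: st => //.
by apply: gcd_tail_simple (G _ ut xD).
Qed.

Definition num_maximal e t : nat := #|` fset_set (maximal_for n e t)|.

Lemma gcd_unique x y g g' : gcd_of x y g -> gcd_of x y g' -> g = g'.
Proof. by move=> [gx gy gP] [gx' gy' gP']; apply: ldiv_anti; auto. Qed.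

(** The maximal elements are sorted by their last entry [s]. The fibre is empty unless the pair of
    [s] and [t] is normal, in which case right multiplication by [s] is a bijection onto it. *)
Lemma num_maximalS t : ldiv t (Delta n) ->
  num_maximal d.+1 t =
  \sum_(i < #|{: simples n}|)
    (num_maximal d (val (enum_val i)) *
     `[< normal_pair n (val (enum_val i)) t >])%N.
Proof.
move=> tD; pose K := fset_set (maximal_for n d.+1 t).
pose tail x s := exists2 x1, x = x1 * s & gcd_of x (Delta n ^+ d) x1.
have tail_uniq x s s' : tail x s -> tail x s' -> s = s'.
  move=> [x1 e g] [x2 e' g']; apply: (@posbraid_mulgI x1).
  by rewrite /= -e e' (gcd_unique g g').
have inK x : (x \in K) = `[< maximal_for n d.+1 t x >].
  by rewrite in_fset_set ?inE //; exact: finite_maximal_for.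
transitivity (\sum_(x <- K) \sum_(i < #|{: simples n}|)
   (`[< tail x (val (enum_val i)) >] : nat))%N.
  rewrite /num_maximal -/K -sum1_size; apply: eq_big_seq => x.
  rewrite inK => /asboolP xK.
  have [x1 [s [e sD st sx1 g]]] := maximal_for_split tD xK.
  have sn : s \in simples n by apply/mem_simples.
  have xs : tail x s by exists x1.
  rewrite (bigD1 (enum_rank [` sn]%fset)) //= enum_rankK asboolT // big1 // => i.
  case: asboolP => // xi /eqP[]; apply: (canRL enum_valK); apply: val_inj => /=.
  exact: tail_uniq xi xs.
rewrite exchange_big /=; apply: eq_bigr => i _.
set s := val (enum_val i).
have sD : ldiv s (Delta n) by apply/mem_simples/valP.
transitivity (count (fun x => `[< tail x s >]) K).
  by rewrite -sum1_count [in RHS]big_mkcond; apply: eq_bigr => x _; case: asboolP.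
case: (asboolP (normal_pair n s t)) => st; last first.
  rewrite muln0; apply/eqP; rewrite -leqn0 leqNgt -has_count; apply/hasPn => x.
  rewrite inK => /asboolP /(maximal_for_split tD) [x1 [s' [e _ s't _ g]]].
  apply/asboolP => xs; apply: st; rewrite (tail_uniq x s s') //.
  by exists x1.
rewrite muln1 -size_filter /num_maximal.
set K' := fset_set _; rewrite -(size_map (fun x => x * s) K').
have inK' x : (x \in K') = `[< maximal_for n d s x >].
  by rewrite in_fset_set ?inE //; exact: finite_maximal_for.
apply/perm_size/uniq_perm; first exact: filter_uniq (fset_uniq _).
  by rewrite map_inj_uniq ?fset_uniq //; apply: posbraid_mulIg.
move=> x; rewrite mem_filter inK; apply/andP/mapP.
  move=> [/asboolP xs /asboolP /(maximal_for_split tD) [x1 [s' [e _ _ m g]]]].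
  have es : s' = s by apply: (tail_uniq x) => //; exists x1.
  by exists x1; rewrite -?es // inK'; apply/asboolP; rewrite -es.
move=> [x1]; rewrite inK' => /asboolP m ->.
have [h1 h2] := maximal_for_join tD sD st m.
by split; apply/asboolP => //; exists x1.
Qed.

End Counting.

(** The source of the row vector of ones. *)
Lemma num_maximal0 n t : num_maximal n 0 t = 1%N.
Proof.
rewrite /num_maximal.
rewrite (_ : maximal_for n 0 t = [set 1]%classic) ?fset_set1 ?cardfs1 //.
apply/seteqP; split=> [x [/ldiv_x1 -> _]|x ->] //.
split; first exact: ldiv_refl.
by move=> u _; rewrite mul1g => /ldiv_x1.
Qed.

Lemma Mn_powE n d (j : 'I_#|{: simples n}|) :
  ((const_mx 1%R *m (Mn n ^+ d)%R : 'rV[int]_#|{: simples n}|) ord0 j =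
   (num_maximal n d (val (enum_val j)))%:R)%R.
Proof.
elim: d j => [|d IH] j; first by rewrite num_maximal0 GRing.expr0 mulmx1 mxE.
rewrite num_maximalS; last exact/mem_simples/valP.
rewrite GRing.exprSr -mulmxE mulmxA mxE GRing.natr_sum; apply: eq_bigr => i _.
rewrite IH mxE GRing.natrM; congr (_ * _%:R)%R; congr nat_of_bool.
apply: asbool_equiv_eq; apply: normal_pairP; exact/mem_simples/valP.
Qed.

(** * Heights *)

Lemma main_idx_pos_word_of m w : pos_word_of m w -> main_idx w = m.
Proof.
move=> [/allP wm _ mw]; apply/eqP; rewrite eqn_leq; apply/andP; split.
  by apply/bigmax_leqP_seq => l lw _; apply: wm.
exact: (@leq_bigmax_seq _ _ xpredT (fun l : nat * bool => l.1) _ mw).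
Qed.

Lemma pos_word_ofP m w : pos_word_of m w -> sigma_positive w.
Proof.
move=> mw; have [_ wf wt] := mw; rewrite /sigma_positive (main_idx_pos_word_of mw).
by split=> // w0; rewrite w0 in wt.
Qed.

Lemma sigma_positive_pos_word_of w : sigma_positive w -> pos_word_of (main_idx w) w.
Proof.
move=> [_ wt wf]; split=> //; apply/allP => l lw; rewrite ltnS.
exact: (@leq_bigmax_seq _ _ xpredT (fun l : nat * bool => l.1) _ lw).
Qed.

Lemma pos_word_of_neq m w v : pos_word_of m w -> letters_lt m v -> bcls w <> bcls v.
Proof.
move=> [/allP wm wf wt] /allP vm; apply: (@sigma_positive_neq w v m) => //.
Qed.

Lemma up_lt_braid z r m x y : (r <= m.+1)%N -> up z m x y ->
  lt_braid r (to_braid x) (to_braid y).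
Proof.
move=> rm [w wP p]; exists w; rewrite (main_idx_pos_word_of wP); split=> //.
  by rewrite (gpath_to_braid p) mulKg.
exact: pos_word_ofP wP.
Qed.

(** Two braids in one left coset of B_r are never related by the order: the letters of [v] lie below
    the main generator of [w], and Property A applies. *)
Lemma lt_braid_nlow r (x y : braid) v : lt_braid r x y -> letters_lt r.-1 v ->
  y <> x * bcls v.
Proof.
move=> [w [e /sigma_positive_pos_word_of wP rw]] vr ey.
apply: (@pos_word_of_neq _ w v wP); last by rewrite e ey mulKg.
by apply: sub_all vr => l /= lr; lia.
Qed.

Definition rmax r z : set posbraid :=
  [set x | ldiv x z /\ forall i, (i.+1 < r)%N -> ~ ldiv (x * sigma i) z]%classic.

(** The first letter of a nontrivial divisor of [Delta r] has index below [r.-1], and all these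
    letters divide [Delta r]. *)
Lemma maximal_for_rmax n d r : maximal_for n d (Delta r) = rmax r (Delta n ^+ d).
Proof.
apply/seteqP; split=> x [xD xP]; split=> //.
  by move=> i ir xi; case: (@sigma_neq1 i); apply: xP => //; apply: sigma_ldiv_Delta.
move=> u ur xu; case: (posbraid_case u) => [//|[i [u' eu]]].
have := bounded_ldiv ur (@bounded_Delta r 1).
rewrite eu => /boundedM [/bounded_sigma ir _].
case: (xP i ir); apply: ldiv_trans xu; apply/ldiv_mul2l.
by rewrite eu; apply: ldiv_mulr.
Qed.

Section Maximal.
Variables (r : nat) (z : posbraid).

Lemma rmax_exists x : ldiv x z -> exists b, bounded_by r b /\ rmax r z (x * b).
Proof.
move=> xz; have [||k [b [br xb <-]] kP] := @ex_max_prop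
  (fun k => exists b, [/\ bounded_by r b, ldiv (x * b) z & plen b = k]) 0 (plen z).
- by exists 1; rewrite mulg1 plen1; split=> //; apply: bounded1.
- by move=> k [b [_ /ldiv_plen xb <-]]; rewrite plenM in xb; lia.
exists b; split=> //; split=> // i ir xbi.
have := kP (plen (b * sigma i)); rewrite plenM plen_sigma => h.
suff : (plen b + 1 <= plen b)%N by lia.
apply: h; exists (b * sigma i); rewrite mulgA plenM plen_sigma; split=> //.
by apply/boundedM; split=> //; apply/bounded_sigma.
Qed.

(** Being a left divisor of [x] with quotient in B_r^+ passes along each edge of the path; thus a
    maximal element is a right multiple of its whole class. *)
Lemma rmax_conn x y : rmax r z x -> conn z r.-1 x y ->
  exists2 b, bounded_by r b & x = y * b.
Proof.
move=> [xz xP] [w wr p].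
suff H u : letters_lt r.-1 u -> forall b y', bounded_by r b -> x = y' * b ->
    forall y, gpath z y' u y -> exists2 b, bounded_by r b & x = y * b.
  by apply: (H w wr 1 x (@bounded1 r) _ y p); rewrite mulg1.
elim: u => [|[i s] u IH] /=.
  by move=> _ b y' br e t [_ <-]; exists b.
move=> /andP[/= ir ur] b y' br e t [y1 [y'z y1z ey] p1].
case: s ey => /= ey; last first.
  apply: (IH ur (sigma i * b) y1) p1; last by rewrite e ey -mulgA.
  by apply/boundedM; split=> //; apply/bounded_sigma; lia.
(* Otherwise the lcm of [b] and [sigma i] begins with [b * sigma j] for some letter [j] of B_r, and
   [x * sigma j] divides [z], against the maximality of [x]. *)
have bi : ldiv (sigma i) b.
  have xb : ldiv (y' * b) z by rewrite -e.
  rewrite ey in y1z.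
  have [c ec] := xb; have [c' ec'] := y1z.
  have yz : ldiv y' z := y'z.
  have [t' zt] := yz.
  have bz : ldiv b t' by apply/(ldiv_mul2l y'); rewrite -zt.
  have iz : ldiv (sigma i) t' by apply/(ldiv_mul2l y'); rewrite -zt.
  have [l [[v bv] il lP]] := lcm_exists bz iz.
  case: (posbraid_case v) => [v1|[j [v' vE]]]; first by rewrite bv v1 mulg1 in il.
  (* A power of [Delta r] is a common multiple inside B_r^+, which keeps the letters of [l] in
     range. *)
  have [k [bk ik]] :
      exists k, ldiv b (Delta r ^+ k) /\ ldiv (sigma i) (Delta r ^+ k).
    have [k bk] := bounded_ldiv_Delta br; exists k.+1; split.
      by apply: ldiv_trans bk _; rewrite expgSr; apply: ldiv_mulr.
    apply: (@ldiv_trans (Delta r)); last by rewrite expgS; apply: ldiv_mulr.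
    by apply: sigma_ldiv_Delta; lia.
  have lr := bounded_ldiv (lP _ bk ik) (@bounded_Delta r k).
  have jr : (j.+1 < r)%N.
    by apply: lr; rewrite bv vE !lettersM letters_sigma eqxx !orbT.
  case: (xP j jr); rewrite e.
  apply: (@ldiv_trans (y' * l)).
    by rewrite bv vE -!mulgA !ldiv_mul2l; apply: ldiv_mulr.
  by rewrite zt ldiv_mul2l; apply: lP.
have [b' eb] := bi; apply: (IH ur b' y1) p1; last by rewrite e eb ey mulgA.
by move: br; rewrite eb => /boundedM [].
Qed.

Lemma rmax_conn_eq x y : rmax r z x -> rmax r z y -> conn z r.-1 x y -> x = y.
Proof.
move=> mx my xy; have [b br e] := rmax_conn mx xy.
case: (posbraid_case b) => [b1|[i [b' eb]]]; first by rewrite e b1 mulg1.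
have ir : (i.+1 < r)%N by apply: br; rewrite eb lettersM letters_sigma eqxx.
case: (my.2 i ir); have [xz _] := mx; apply: ldiv_trans xz.
by rewrite e eb mulgA; apply: ldiv_mulr.
Qed.

Lemma to_braid_bounded b : bounded_by r b ->
  exists2 v, letters_lt r.-1 v & to_braid b = bcls v.
Proof.
move=> br; exists (pos_word (repr b)).
  apply/allP => l /mapP [i ib ->] /=; have : (i.+1 < r)%N by apply: br.
  lia.
by rewrite -to_braid_cls pcls_repr.
Qed.

(** Sending [x] to a maximal element [x * b] of its class is injective on a chain: [x * b = y * b']
    would put [x] and [y] in one left coset of B_r. *)
Lemma chain_card (A : {fset posbraid}) : (forall x, x \in A -> ldiv x z) ->
  lt_chain r A -> (#|` A| <= #|` fset_set (rmax r z)|)%N.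
Proof.
move=> Az chA.
have [f fP] : exists f : posbraid -> posbraid, forall x, ldiv x z ->
    exists b, [/\ bounded_by r b, rmax r z (x * b) & f x = x * b].
  suff /choice [f fP] : forall x, exists y, ldiv x z ->
      exists b, [/\ bounded_by r b, rmax r z (x * b) & y = x * b] by exists f.
  move=> x; have [xz|xz] := pselect (ldiv x z); last by exists 1.
  by have [b [br xb]] := rmax_exists xz; exists (x * b) => _; exists b.
have low x y b b' : lt_braid r (to_braid x) (to_braid y) ->
    bounded_by r b -> bounded_by r b' -> x * b = y * b' -> False.
  move=> xy /to_braid_bounded [v vr ev] /to_braid_bounded [v' v'r ev'] e.
  apply: (@lt_braid_nlow _ _ _ (v ++ inv_word v') xy).
    by rewrite letters_lt_cat vr letters_lt_inv.
  have := congr1 to_braid e; rewrite !to_braidM ev ev' bcls_cat mulgA => ->.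
  have vv : bcls v' * bcls (inv_word v') = 1.
    by rewrite -bcls_cat; apply/clsP/mul_inv_word.
  by rewrite -mulgA vv mulg1.
rewrite -(size_map f A); apply: uniq_leq_size.
  rewrite map_inj_in_uniq ?fset_uniq // => x y xA yA fxy.
  have [//|xy] := pselect (x = y).
  have [b [br _ eb]] := fP x (Az x xA); have [b' [b'r _ eb']] := fP y (Az y yA).
  have e : x * b = y * b' by rewrite -eb -eb'.
  case: (chA x y xA yA xy) => h; first by case: (low _ _ _ _ h br b'r).
  by case: (low _ _ _ _ h b'r br).
move=> _ /mapP [x xA ->]; have [b [_ m ->]] := fP x (Az x xA).
rewrite in_fset_set ?inE //.
by apply: sub_finite_set (finite_Div z) => t [].
Qed.

End Maximal.

Lemma gpath_pos_word z x u : ldiv (x * pcls u) z ->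
  gpath z x (pos_word u) (x * pcls u).
Proof.
elim: u x => [|i u IH] x; first by rewrite mulg1.
rewrite pcls_cons mulgA => xz; exists (x * sigma i); last exact: IH.
by apply: edge_pos; apply: ldivMl xz.
Qed.

Lemma conn_Div z m x y : (forall i, i \in letters z -> (i < m)%N) ->
  ldiv x z -> ldiv y z -> conn z m x y.
Proof.
move=> zm; have H t : ldiv t z -> conn z m 1 t.
  move=> tz; exists (pos_word (repr t)).
    apply/allP => l /mapP [i ib ->] /=; apply: zm.
    exact: (ldiv_letters tz).
  have := @gpath_pos_word z 1 (repr t); rewrite mul1g pcls_repr; exact.
by move=> xz yz; apply: conn_trans (H y yz); apply/conn_sym/H.
Qed.

(** Comparability is used at the levels k-1, k-2 and so on, until a strict comparison appears or
    level [r] is reached. *)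
Lemma conn_down z r k x y : (r <= k)%N -> conn z k x y ->
  conn z r x y \/ exists2 m, (r <= m < k)%N & up z m x y \/ up z m y x.
Proof.
elim: k => [|k IH]; first by rewrite leqn0 => /eqP ->; left.
rewrite leq_eqVlt => /orP[/eqP -> |rk]; first by left.
move=> /comparable_belowP [h|h|h].
- have [?|[m /andP[rm mk] h']] := IH rk h; [by left|right; exists m => //].
  by rewrite rm ltnS ltnW.
- by right; exists k; [rewrite -ltnS rk ltnSn|left].
- by right; exists k; [rewrite -ltnS rk ltnSn|right].
Qed.

Lemma finite_rmax r z : finite_set (rmax r z).
Proof. by apply: sub_finite_set (finite_Div z) => t []. Qed.

Lemma mem_rmax r z x : x \in fset_set (rmax r z) <-> rmax r z x.
Proof. by rewrite (in_fset_set (finite_rmax r z)); split; rewrite inE. Qed.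

Lemma rmax_up r z x y : (0 < r)%N -> rmax r z x -> rmax r z y -> x <> y ->
  exists2 m, (r <= m.+1)%N & up z m x y \/ up z m y x.
Proof.
move=> r0 mx my xy; have [[xz _] [yz _]] := (mx, my).
(* At this level all divisors of [z] form one component; the maximum with [r] lets the descent stop
   at [r.-1]. *)
pose k := maxn r (\max_(i <- repr z) i.+1).
have : conn z k x y.
  apply: conn_Div => // i iz; rewrite leq_max; apply/orP; right.
  exact: (@leq_bigmax_seq _ _ xpredT (fun i : nat => i.+1) _ iz).
have rk : (r.-1 <= k)%N by apply: leq_trans (leq_pred r) (leq_maxl _ _).
case/(conn_down rk) => [h|[m rm h]]; first by case: xy; apply: rmax_conn_eq h.
by exists m => //; lia.
Qed.

Lemma card_rmax_gt0 r z : (0 < #|` fset_set (rmax r z)|)%N.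
Proof.
have [b [_ bP]] := rmax_exists r (ldiv1 z).
by rewrite cardfs_gt0; apply/fset0Pn; exists (1 * b); apply/mem_rmax.
Qed.

Lemma height_rmax r z : (0 < r)%N ->
  is_height r z #|` fset_set (rmax r z)|.
Proof.
move=> r0; split; last by move=> k [A [Az chA <-]]; apply: chain_card.
exists (fset_set (rmax r z)); split=> //.
  by move=> x /mem_rmax [].
move=> x y /mem_rmax mx /mem_rmax my xy.
have [m rm [h|h]] := rmax_up r0 mx my xy; [left|right];
  exact: up_lt_braid h.
Qed.

(** * Complexity and words drawn in the divisor graph *)

Section Complexity.
Variables (z : posbraid) (m : nat).
Hypothesis zm : forall i, i \in letters z -> (i <= m)%N.

Lemma drawn_prefix x u v : drawn z x (u ++ v) -> drawn z x u.
Proof. by move=> h t /prefixP [s e]; apply: h; rewrite e -catA prefix_prefix. Qed.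

Lemma drawn_nil x : ldiv x z -> drawn z x [::].
Proof. by move=> xz [|//] _; exists x; rewrite ?mulg1. Qed.

(** Property A again: the left side is sigma_M-positive while [y'] has only letters below [M]. So no
    drawn word uses a letter above the main generator of [z]. *)
Lemma to_braid_high y y' M : ldiv y z -> ldiv y' z -> (m < M)%N ->
  to_braid y * bcls [:: (M, true)] <> to_braid y'.
Proof.
move=> yz y'z mM.
have [v vM ev] : exists2 v, letters_lt M (pos_word v) & y = pcls v.
  exists (repr y); last by rewrite pcls_repr.
  apply/allP => l /mapP [i ib ->] /=; apply: leq_ltn_trans mM; apply: zm.
  exact: (ldiv_letters yz).
have [v' v'M ev'] : exists2 v, letters_lt M (pos_word v) & y' = pcls v.
  exists (repr y'); last by rewrite pcls_repr.
  apply/allP => l /mapP [i ib ->] /=; apply: leq_ltn_trans mM; apply: zm.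
  exact: (ldiv_letters y'z).
rewrite ev ev' !to_braid_cls -bcls_cat; apply: (@pos_word_of_neq M) => //.
split; rewrite ?letters_lt_cat ?mem_cat ?negb_or ?inE ?eqxx ?orbT //.
  by rewrite letters_ltW //= ltnSn.
by rewrite letters_lt_notin //= xpair_eqE andbF.
Qed.

Lemma drawn_letter x w l : drawn z x w -> l \in w -> (l.1 <= m)%N.
Proof.
move=> dw /path.splitPr lw; case: lw dw => u v dw.
have [|y yz ey] := dw u; first exact: prefix_prefix.
have [|y' y'z ey'] := dw (u ++ [:: l]).
  by rewrite -[l :: v]cat1s catA prefix_prefix.
rewrite leqNgt; apply/negP => mM.
move: ey'; rewrite bcls_cat mulgA ey; case: l mM dw => M [] /= mM _.
  exact: to_braid_high.
move=> e; apply: (to_braid_high y'z yz mM).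
by rewrite -e -mulgA bcls_letter mulg1.
Qed.

(** The chain consists of the origin and the vertices reached after each letter sigma_m. The last
    clause keeps the remaining word from each element to the current vertex, so that the next
    sigma_m puts all of them below the new vertex. *)
Lemma drawn_chain x w : ldiv x z -> drawn z x w -> letters_lt m.+1 w ->
    (m, false) \notin w ->
  exists A : {fset posbraid}, [/\ forall a, a \in A -> ldiv a z, lt_chain m.+1 A,
    #|` A| = (count_mem (m, true) w).+1 &
    forall a, a \in A -> exists v, [/\ letters_lt m.+1 v, (m, false) \notin v &
      to_braid a * bcls v = to_braid x * bcls w]].
Proof.
move=> xz; elim/last_ind: w => [|w [i b] IH].
  move=> _ _ _; exists [fset x]%fset; split=> [a|a a'||a]; rewrite ?cardfs1 ?inE //.
  - by move=> /eqP ->.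
  - by move=> /eqP -> /eqP ->.
  - by move=> /eqP ->; exists [::].
rewrite -cats1 letters_lt_cat mem_cat negb_or count_cat inE => dw.
move=> /andP[wm /andP[/= im _]] /andP[wf ib].
have [A [Az chA cA Aw]] := IH (drawn_prefix dw) wm wf.
have ibm : letters_lt m.+1 [:: (i, b)] by rewrite /letters_lt /= im.
have ibf : (m, false) \notin [:: (i, b)] by rewrite inE.
have Aw' a : a \in A -> exists v, [/\ letters_lt m.+1 v, (m, false) \notin v &
    to_braid a * bcls (v ++ [:: (i, b)]) = to_braid x * bcls (w ++ [:: (i, b)])].
  move=> /Aw [v [vm vf e]]; exists v; split=> //.
  by rewrite !bcls_cat !mulgA e.
case: (eqVneq (i, b) (m, true)) => [[ei eb]|_]; last first.
  exists A; split=> //; first by rewrite !addn0.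
  move=> a /Aw' [v [vm vf e]]; exists (v ++ [:: (i, b)]); split=> //.
    by rewrite letters_lt_cat vm.
  by rewrite mem_cat negb_or vf.
subst i b; have [|y yz ey] := dw (w ++ [:: (m, true)]); first by rewrite prefix_refl.
have Ay a : a \in A -> lt_braid m.+1 (to_braid a) (to_braid y).
  move=> /Aw' [v [vm vf e]]; exists (v ++ [:: (m, true)]).
  have vP : pos_word_of m (v ++ [:: (m, true)]).
    split; first by rewrite letters_lt_cat vm.
      by rewrite mem_cat negb_or vf.
    by rewrite mem_cat mem_head orbT.
  rewrite (main_idx_pos_word_of vP) -ey -e mulKg; split=> //.
  exact: pos_word_ofP vP.
have yA : y \notin A.
  apply/negP => /Ay [v [e /sigma_positive_pos_word_of vP _]].
  by apply: (@pos_word_of_neq _ v [::] vP) => //; rewrite e mulVg.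
exists (y |` A)%fset; split.
- by move=> a; rewrite !inE => /orP[/eqP ->|/Az].
- move=> a a'; rewrite !inE => /orP[/eqP ->|aA] /orP[/eqP ->|a'A] // aa'.
  + by right; apply: Ay.
  + by left; apply: Ay.
  + exact: chA.
- by rewrite cardfsU1 yA cA /= addn0 addn1.
move=> a; rewrite !inE => /orP[/eqP ->|/Aw' [v [vm vf e]]].
  by exists [::]; split=> //; rewrite mulg1.
exists (v ++ [:: (m, true)]); split=> //.
  by rewrite letters_lt_cat vm.
by rewrite mem_cat negb_or vf.
Qed.

Lemma count_le_rmax x w : ldiv x z -> drawn z x w -> sigma_positive w ->
  (count_mem (m, true) w < #|` fset_set (rmax m.+1 z)|)%N.
Proof.
move=> xz dw /sigma_positive_pos_word_of [wm wf wt].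
have Mm := drawn_letter dw wt; rewrite /= in Mm.
have [||A [Az chA <- _]] := drawn_chain xz dw; last exact: chain_card.
  by apply: sub_all wm => l /= lM; apply: leq_trans lM _.
move: Mm wf; rewrite leq_eqVlt => /orP[/eqP -> //|Mm _].
apply/negP => /(allP wm) /=; lia.
Qed.

(** The maximal elements are totally ordered; the concatenated paths between successive ones contain
    at least one sigma_m each and no inverse of it. *)
Lemma rmax_drawn : exists x w, [/\ ldiv x z, drawn z x w, letters_lt m.+1 w,
  (m, false) \notin w &
  (#|` fset_set (rmax m.+1 z)| <= (count_mem (m, true) w).+1)%N].
Proof.
pose le x y := `[< x = y \/ up z m x y >].
set K := fset_set _.
have Kup x y : rmax m.+1 z x -> rmax m.+1 z y -> x <> y -> up z m x y \/ up z m y x.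
  move=> mx my xy; have : conn z m.+1 x y.
    by apply: conn_Div; [move=> i /zm|case: mx|case: my].
  case/comparable_belowP => [h||]; [|by left|by right].
  by case: xy; apply: (rmax_conn_eq mx my h).
have le_total : {in [pred x | `[< rmax m.+1 z x >]] &, total le}.
  move=> x y /asboolP mx /asboolP my; apply/orP.
  have [->|xy] := pselect (x = y); first by left; apply/asboolP; left.
  by case: (Kup x y mx my xy) => h; [left|right]; apply/asboolP; right.
have : sorted le (sort le K).
  apply: (sort_sorted_in le_total).
  by apply/allP => x /mem_rmax mx; apply/asboolP.
have szK : size (sort le K) = #|` K| by rewrite size_sort.
have uK : uniq (sort le K) by rewrite sort_uniq fset_uniq.
have Kz x : x \in sort le K -> ldiv x z by rewrite mem_sort => /mem_rmax [].
rewrite -szK; case: (sort le K) uK Kz => [|x s] uK Kz /= sK.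
  by exists 1, [::]; split=> //; [exact: ldiv1|apply/drawn_nil/ldiv1].
have [w [wm wf p sz]] : exists w, [/\ letters_lt m.+1 w, (m, false) \notin w,
    gpath z x w (last x s) & (size s <= count_mem (m, true) w)%N].
  elim: s x uK Kz sK => [|y s IH] x uK Kz.
    by exists [::]; split=> //; split=> //; apply/Kz/mem_head.
  move=> /= /andP[/asboolP xy sK].
  have {xy} [u [um uf ut] pu] : up z m x y.
    by case: xy uK => // ->; rewrite /= mem_head.
  have [||w [wm wf p sz]] := IH y _ _ sK; first by case/andP: uK.
    by move=> t ty; apply: Kz; rewrite inE ty orbT.
  exists (u ++ w); split.
  - by rewrite letters_lt_cat um.
  - by rewrite mem_cat negb_or uf.
  - by apply/gpath_cat; exists y.
  - rewrite count_cat -add1n leq_add //.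
    by rewrite -has_count has_pred1.
by exists x, w; split=> //; [case: (gpath_Div p)|exact: gpath_drawn p].
Qed.

Lemma complexity_rmax : ldiv (sigma m) z ->
  is_complexity z (#|` fset_set (rmax m.+1 z)|).-1.
Proof.
move=> mz; have mlz : m \in letters z.
  by apply: (ldiv_letters mz); rewrite letters_sigma.
have ub k : (exists x w, [/\ Div z x, drawn z x w, sigma_positive w &
    count_mem (m, true) w = k]) -> (k < #|` fset_set (rmax m.+1 z)|)%N.
  by move=> [x [w [xz dw wP <-]]]; exact: (count_le_rmax xz dw wP).
(* The one-letter word sigma_m drawn from 1 shows that there are at least two classes; hence the
   word of [rmax_drawn] does contain sigma_m and is sigma-positive. *)
have c1 : (1 < #|` fset_set (rmax m.+1 z)|)%N.
  apply: ub; exists 1, [:: (m, true)]; split; [exact: ldiv1| | |by rewrite /= eqxx].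
    apply: (@gpath_drawn _ _ _ (sigma m)); exists (sigma m); last by split.
    by have := @edge_pos z 1 m; rewrite mul1g; apply.
  apply: (@pos_word_ofP m); split; rewrite ?mem_head ?inE ?xpair_eqE ?andbF //.
  by rewrite /letters_lt /= ltnSn.
exists m.
  exists (repr z); rewrite pcls_repr; split=> //.
    by move=> e; rewrite inE e in mlz.
  apply: main_idx_pos_word_of; split.
  - by apply/allP => l /mapP [i iz ->] /=; rewrite ltnS zm.
  - by apply/negP => /mapP [].
  - by apply/mapP; exists m.
have [x [w [xz dw wm wf wK]]] := rmax_drawn.
have wt : (m, true) \in w.
  by rewrite -has_pred1 has_count; lia.
have wP : sigma_positive w by apply: (@pos_word_ofP m).
split; last by move=> k /ub; lia.
exists x, w; split=> //; have := count_le_rmax xz dw wP; lia.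
Qed.

End Complexity.

Local Close Scope group_scope.
Local Open Scope ring_scope.

Theorem proposition3p15 :
  (forall (n r d : nat) (r_gt0 : (0 < r)%N) (le_rn : (r <= n)%N)
      (d_gt0 : (0 < d)%N),
    exists2 h : nat, is_height r (Delta n ^+ d)%g h &
      h%:Z = (const_mx 1 *m Mn n ^+ d : 'rV_#|{: simples n}|) ord0 (Delta_idx le_rn))
  /\
  (forall (n d : nat) (n_gt1 : (1 < n)%N) (d_gt0 : (0 < d)%N),
    exists2 c : nat, is_complexity (Delta n ^+ d)%g c &
      c%:Z = (const_mx 1 *m Mn n ^+ d : 'rV_#|{: simples n}|) ord0
               (Delta_idx (leq_pred n)) - 1).
Proof.
split=> [n r d r0 rn d0|n d n1 d0].
  exists (num_maximal n d (Delta r)).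
    by rewrite /num_maximal maximal_for_rmax; apply: height_rmax.
  by rewrite Mn_powE enum_rankK /= natz.
(* The count is positive, so its natural predecessor agrees with integer subtraction. *)
exists (num_maximal n d (Delta n.-1)).-1; last first.
  rewrite Mn_powE enum_rankK /= natz predn_int //.
  by rewrite /num_maximal maximal_for_rmax card_rmax_gt0.
(* For [n.+2] strands the main generator is the letter [n], and the classes are those modulo
   B_(n+1). *)
rewrite /num_maximal maximal_for_rmax; case: n n1 => // -[//|n] _ /=.
apply: complexity_rmax => [i /(@bounded_Delta n.+2 d)|]; first by rewrite !ltnS.
case: d d0 => // d _; rewrite expgS.
by apply: (@ldiv_trans (Delta n.+2)); [exact: sigma_ldiv_Delta|exact: ldiv_mulr].
Qed.
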